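(* Let $0 < p \leq q$. If $0<p<1$, then $$\dim_{\mathrm{A}}^\theta S_{p,q} = \begin{cases} \dfrac{2+q-p}{(1+q)(1-\theta)} & \text{if } 0 \le \theta < p/(1+q),\\[2mm] \dfrac{2+q-\theta(1+q)}{(1+q)(1-\theta)} & \text{if } p/(1+q) \le \theta < q/(1+q),\\[2mm] 2 & \text{if } q/(1+q) \le \theta < 1.\end{cases}$$ Otherwise, if $p \ge 1$, then $$\dim_{\mathrm{A}}^\theta S_{p,q} = \begin{cases} \dfrac{p-\theta(p-1)}{p(1-\theta)} & \text{if } 0 \le \theta < p/(1+q),\\[2mm] \dfrac{2+q-\theta(1+q)}{(1+q)(1-\theta)} & \text{if } p/(1+q) \le \theta < q/(1+q),\\[2mm] 2 & \text{if } q/(1+q) \le \theta < 1.\end{cases}$$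
   Context: For $0<p\le q$, the elliptical polynomial spiral is $S_{p,q} = \{ t^{-p}\cos t + i\, t^{-q}\sin t : 1 < t < \infty\} \subset \mathbb{C} \cong \mathbb{R}^2$. For bounded $F\subset\mathbb{R}^n$ and $\theta\in[0,1)$, the Assouad spectrum of $F$ at $\theta$ is $$\dim_{\mathrm{A}}^\theta F = \inf\{\alpha\ge 0 : \exists\, C>0 \text{ such that for all } 0<r<1 \text{ and } x\in F,\ N_r(B(x,r^\theta)\cap F) \le C (r^\theta/r)^\alpha\},$$ where $N_r(E)$ is the smallest number of hypercubes of sidelength $r$ required to cover $E$ and $B(x,R)$ is the ball with centre $x$ and radius $R$. *)

(* Defs.v *)
From HB Require Import structures.
From mathcomp Require Import all_boot all_order all_algebra.
From mathcomp Require Import all_classical all_reals all_analysis.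
From mathcomp Require Import complex.

Set Implicit Arguments.
Unset Strict Implicit.
Unset Printing Implicit Defensive.

Import Order.TTheory GRing.Theory Num.Theory.

Local Open Scope classical_set_scope.
Local Open Scope complex_scope.
Local Open Scope ring_scope.

(* The library's norm and balls on 'rV[R]_n are those of the sup norm, hence
   the explicit Euclidean distance. *)
Definition eucl_dist (R : realType) (n : nat) (x y : 'rV[R]_n) : R :=
  Num.sqrt (\sum_(j < n) (x 0 j - y 0 j) ^+ 2).

Definition eucl_ball (R : realType) (n : nat) (x : 'rV[R]_n) (rho : R) :
  set 'rV[R]_n := [set y | eucl_dist x y <= rho].

(* Closed axis-parallel hypercube of sidelength r with lowest corner c. *)
Definition hypercube (R : realType) (n : nat) (c : 'rV[R]_n) (r : R) :
  set 'rV[R]_n := [set y | forall j, c 0 j <= y 0 j <= c 0 j + r].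

Definition covered_by (R : realType) (n : nat) (E : set 'rV[R]_n) (r : R)
  (k : nat) : Prop :=
  exists c : 'I_k -> 'rV[R]_n, E `<=` \bigcup_i hypercube (c i) r.

(* N_r(E), equal to +oo when no finite family of hypercubes covers E. *)
Definition covering_number (R : realType) (n : nat) (r : R)
  (E : set 'rV[R]_n) : \bar R :=
  ereal_inf [set k%:R%:E | k in covered_by E r].

Definition assouad_spectrum (R : realType) (n : nat) (theta : R)
  (F : set 'rV[R]_n) : \bar R :=
  ereal_inf [set alpha%:E | alpha in [set alpha : R | 0 <= alpha /\
    exists2 C : R, 0 < C &
      forall (r : R) (x : 'rV[R]_n), 0 < r < 1 -> F x ->
        (covering_number r (eucl_ball x (r `^ theta) `&` F)
           <= (C * (r `^ theta / r) `^ alpha)%:E)%E]].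

Definition elliptical_spiral (R : realType) (p q : R) : set R[i] :=
  [set (t `^ (- p) * cos t) +i* (t `^ (- q) * sin t) | t in [set t | 1 < t]].

(* The identification of the complex plane with R^2. *)
Definition plane_of_complex (R : realType) (z : R[i]) : 'rV[R]_2 :=
  \row_(j < 2) (if j == 0 then complex.Re z else complex.Im z).

(* Main.v *)
(* Write R = r^theta and kappa = r^(-1/(1+q)), the index beyond which consecutive
   turns are vertically closer than r. Turn number t is a curve of width about
   t^-p, piecewise monotone in both coordinates, so a ball of radius R meets it
   in about min(t^-p, R)/r cubes of side r; all turns beyond kappa lie in a
   rectangle of width min(kappa^-p, R) and height kappa^-q = r kappa, which costs
   kappa min(kappa^-p, R)/r cubes. Bounding min(t^-p, R) by t^-p, by R, or (for
   p >= 1) by t^-1 R^(1-1/p) and summing over t <= kappa gives the upper bounds.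

   For the lower bounds, take about l/D turns spaced by D among those of index
   between l and 3l, and on each of them points whose abscissas are spaced by a
   multiple of r and whose angles have cosine at most Lam <= 1/2. If turns at
   distance D are more than 4r apart vertically, no cube of side r contains two of
   these points. The parameters are l ~ kappa (p < 1 with small theta, middle range),
   l ~ R^(-1/p) (p >= 1, small theta) and l ~ R^(-1/q), with D > 1 only in the
   last case. *)
Require Import Defs.
From mathcomp Require Import all_boot all_order all_algebra.
From mathcomp Require Import all_classical all_reals all_analysis.
From mathcomp Require Import complex ring lra.

Set Implicit Arguments.
Unset Strict Implicit.
Unset Printing Implicit Defensive.

Import Order.TTheory GRing.Theory Num.Theory.
Import numFieldNormedType.Exports.

Local Open Scope classical_set_scope.
Local Open Scope ring_scope.

(* [functions] exports another [covered_by]. *)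
Local Notation covered_by := Defs.covered_by.

(** * Covering numbers *)

(** The bound is a real number, so that counts of several pieces can be added and compared without
    rounding. *)
Definition cubes_suffice (R : realType) (n : nat) (r : R) (E : set 'rV[R]_n)
    (B : R) : Prop :=
  exists2 k, covered_by E r k & k%:R <= B.

Section Covering.
Context {R : realType} {n : nat}.
Implicit Types (r B w : R) (E : set 'rV[R]_n).

(** Arbitrary finite index types let unions be indexed by sums and grids by products. *)
Lemma covered_by_fin (I : finType) (c : I -> 'rV[R]_n) E r :
  (forall y, E y -> exists i, hypercube (c i) r y) -> covered_by E r #|I|.
Proof.
move=> cE; exists (fun i => c (enum_val i)) => y /cE[i ci].
by exists (enum_rank i) => //=; rewrite enum_rankK.
Qed.

Lemma cubes_suffice_le E E' r B B' :
  E' `<=` E -> B <= B' -> cubes_suffice r E B -> cubes_suffice r E' B'.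
Proof.
move=> sE leB [k [c cE] kB]; exists k; last exact: le_trans leB.
by exists c; apply: subset_trans cE.
Qed.

Lemma cubes_suffice0 r : cubes_suffice r (set0 : set 'rV[R]_n) 0.
Proof. by exists 0%N; [exists (fun=> 0)|]. Qed.

Lemma cubes_sufficeU E E' r B B' :
  cubes_suffice r E B -> cubes_suffice r E' B' ->
  cubes_suffice r (E `|` E') (B + B').
Proof.
move=> [k [c cE] kB] [k' [c' cE'] kB'].
exists (k + k')%N; last by rewrite natrD lerD.
have -> : (k + k')%N = #|{: 'I_k + 'I_k'}| by rewrite card_sum !card_ord.
apply: (covered_by_fin (c := fun s => match s with inl i => c i | inr i => c' i end)).
by move=> y [/cE[i _ ?]|/cE'[i _ ?]]; [exists (inl i)|exists (inr i)].
Qed.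

Lemma cubes_suffice_sum (M : nat) (F : nat -> set 'rV[R]_n) r (B : nat -> R) :
  (forall m, (m < M)%N -> cubes_suffice r (F m) (B m)) ->
  cubes_suffice r [set y | exists2 m, (m < M)%N & F m y] (\sum_(m < M) B m).
Proof.
elim: M => [|M IH] FB.
  rewrite big_ord0; apply: cubes_suffice_le (cubes_suffice0 r) => //.
  by move=> y [].
rewrite big_ord_recr /=.
apply: cubes_suffice_le (cubes_sufficeU (IH _) (FB M _)) => //; last first.
  by move=> m mM; apply: FB; rewrite ltnS ltnW.
move=> y [m]; rewrite ltnS leq_eqVlt => /predU1P[->|mM] Fy; first by right.
by left; exists m.
Qed.

(* Steps of length r/2 in the range of [u] cut the family into pieces of
   sup-diameter at most r/2. *)
Lemma cubes_suffice_dominated (T : choiceType) (D : set T) (z : T -> 'rV[R]_n)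
    (u : T -> R) u0 w r :
  0 < r -> 0 <= w ->
  (forall t, D t -> u0 <= u t <= u0 + w) ->
  (forall t t' j, D t -> D t' -> `|z t 0 j - z t' 0 j| <= `|u t - u t'|) ->
  cubes_suffice r (z @` D) (2 * w / r + 1).
Proof.
move=> r0 w0 uD zD.
have w2r : 0 <= 2 * w / r by rewrite divr_ge0 ?mulr_ge0 // ltW.
pose idx t := Num.truncn (2 * (u t - u0) / r).
exists (Num.truncn (2 * w / r)).+1; last first.
  by rewrite -natr1 lerD2r truncn_le.
case: (pselect (exists t, D t)) => [[t0 Dt0]|nD]; last first.
  by exists (fun=> 0) => y [t Dt]; case: nD; exists t.
(* One representative is chosen per index; an index that no point attains gets the default [t0]. *)
have repr i : exists t, D t /\ forall t', D t' -> idx t' = i -> idx t = i.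
  case: (pselect (exists t, D t /\ idx t = i)) => [[t [Dt it]]|ni].
    by exists t.
  by exists t0; split => // t' Dt' it'; case: ni; exists t'.
have [rep repP] := boolp.choice repr.
(* Each cube is centred at its representative, since points of equal index differ by at most r/2 in
   every coordinate. *)
exists (fun i : 'I_ _ => \row_j (z (rep i) 0 j - r / 2)) => _ [t Dt <-].
have ut0 t' : D t' -> 0 <= 2 * (u t' - u0) / r.
  by move=> /uD/andP[]; rewrite -subr_ge0 => h _; rewrite divr_ge0 ?mulr_ge0 // ltW.
have idxM : (idx t < (Num.truncn (2 * w / r)).+1)%N.
  rewrite ltnS; apply: le_truncn; rewrite ler_pM2r ?invr_gt0 // ler_pM2l //.
  by rewrite lerBlDl; case/andP: (uD _ Dt).
exists (Ordinal idxM) => //= j; rewrite mxE.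
have [Dp] := repP (idx t); move/(_ _ Dt erefl) => ip.
have step a b : D a -> D b -> idx a = idx b -> u a - u b <= r / 2.
  move=> Da Db ab.
  have /andP[_ h1] := truncn_itv (ut0 _ Da).
  have /andP[h2 _] := truncn_itv (ut0 _ Db).
  rewrite -/(idx a) ab -/(idx b) in h1 h2.
  have : 2 * (u a - u0) / r < 2 * (u b - u0) / r + 1.
    by apply: (lt_le_trans h1); rewrite -[leLHS]natr1 lerD2r.
  rewrite -ltrBlDl -mulrBl ltr_pdivrMr // mul1r; lra.
have := zD _ _ j Dt Dp; set d := `|u t - u _|.
have dr : d <= r / 2.
  by rewrite /d ler_norml lerNl opprB !step.
move=> /le_trans/(_ dr); rewrite ler_norml; lra.
Qed.

End Covering.

Lemma cubes_suffice_rect (R : realType) (E : set 'rV[R]_2) (a b w h r : R) :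
  0 < r -> 0 <= w -> 0 <= h ->
  (forall y, E y -> a <= y 0 0 <= a + w /\ b <= y 0 1 <= b + h) ->
  cubes_suffice r E ((w / r + 1) * (h / r + 1)).
Proof.
move=> r0 w0 h0 Eab.
have wr0 : 0 <= w / r by rewrite divr_ge0 // ltW.
have hr0 : 0 <= h / r by rewrite divr_ge0 // ltW.
set k := (Num.truncn (w / r)).+1; set l := (Num.truncn (h / r)).+1.
exists (k * l)%N; last first.
  by rewrite natrM ler_pM // /k /l -natr1 lerD2r truncn_le.
have -> : (k * l)%N = #|{: 'I_k * 'I_l}| by rewrite card_prod !card_ord.
apply: (covered_by_fin (c := fun i : 'I_k * 'I_l =>
  \row_j (if j == 0 then a + i.1%:R * r else b + i.2%:R * r))).
move=> y /Eab[/andP[y1 y2] /andP[y3 y4]].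
have it x s : 0 <= x - s -> s + (Num.truncn ((x - s) / r))%:R * r <= x
    <= s + (Num.truncn ((x - s) / r))%:R * r + r.
  move=> xs; have /truncn_itv : 0 <= (x - s) / r by rewrite divr_ge0 // ltW.
  by rewrite -natr1 ler_pdivlMr // ltr_pdivrMr // mulrDl; lra.
have lt x s v : x <= s + v -> (Num.truncn ((x - s) / r) < (Num.truncn (v / r)).+1)%N.
  by move=> xs; rewrite ltnS; apply: le_truncn; rewrite ler_pM2r ?invr_gt0 //; lra.
exists (Ordinal (lt _ _ _ y2), Ordinal (lt _ _ _ y4)) => j; rewrite mxE /=.
have [->|j0] := eqVneq j 0; first by apply: it; lra.
have -> : j = 1 by apply/val_inj; case: j j0 => -[|[]].
by apply: it; lra.
Qed.

Lemma gt0_powRD (R : realType) (r x y : R) :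
  0 < r -> r `^ (x + y) = r `^ x * r `^ y.
Proof. by move=> r0; rewrite powRD // (gt_eqF r0) implybT. Qed.

Lemma powRB_id (R : realType) (r theta : R) :
  0 < r -> r `^ theta / r = r `^ (- (1 - theta)).
Proof.
by move=> r0; rewrite opprB gt0_powRD // powRN powRr1 // ltW.
Qed.

(** * Criteria for upper and lower bounds on the Assouad spectrum *)

Section Criteria.
Context {R : realType} {n : nat}.
Implicit Types (theta s : R) (F : set 'rV[R]_n).

Lemma covering_number_le F r (B : R) :
  cubes_suffice r F B -> (covering_number r F <= B%:E)%E.
Proof.
move=> [k Fk kB]; apply: (@le_trans _ _ (k%:R%:E)); last by rewrite lee_fin.
by apply: ereal_inf_lbound; exists k.
Qed.

Lemma covering_number_ge F r (B : R) :
  (forall k, covered_by F r k -> B <= k%:R) -> (B%:E <= covering_number r F)%E.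
Proof.
by move=> FB; apply/ereal_infP => _ [k Fk <-]; rewrite lee_fin FB.
Qed.

(** The spectrum is an infimum, so the exponents [s + e] suffice. The slack [e] absorbs the
    divergence of the sum of 1/t when p >= 1. *)
Lemma assouad_spectrum_le theta s F : 0 <= s ->
  (forall e : R, 0 < e -> exists2 C : R, 0 < C & forall r x, 0 < r < 1 -> F x ->
     cubes_suffice r (eucl_ball x (r `^ theta) `&` F)
       (C * (r `^ theta / r) `^ (s + e))) ->
  (assouad_spectrum theta F <= s%:E)%E.
Proof.
move=> s0 cF; apply/lee_addgt0Pr => e e0; rewrite -EFinD.
apply: ereal_inf_lbound; exists (s + e) => //=; split; first by rewrite addr_ge0 // ltW.
have [C C0 CP] := cF e e0; exists C => // r x r01 Fx.
exact: covering_number_le (CP _ _ r01 Fx).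
Qed.

(* The ratio r^theta / r is unbounded as r -> 0. *)
Lemma assouad_spectrum_ge theta s c F : 0 <= theta < 1 -> 0 < c ->
  (exists2 r0, 0 < r0 & forall r, 0 < r < r0 -> exists2 x, F x &
     forall k, covered_by (eucl_ball x (r `^ theta) `&` F) r k ->
       c * (r `^ theta / r) `^ s <= k%:R) ->
  (s%:E <= assouad_spectrum theta F)%E.
Proof.
move=> /andP[th0 th1] c0 [r0 r00 rF]; apply/ereal_infP => _ [al [al0 [C C0 CP]] <-].
rewrite lee_fin leNgt; apply/negP => als.
(* Chosen so that c y^(s - al) = C + c, which exceeds C. *)
pose y := (C / c + 1) `^ ((s - al)^-1).
have Cc : 0 < C / c + 1 by rewrite addr_gt0 ?divr_gt0.
have y0 : 0 < y by rewrite powR_gt0.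
(* The first term makes r^theta / r at least [y]; the other two give [r < r0] and [r < 1]. *)
pose r := Num.min (y `^ (- (1 - theta)^-1)) (Num.min (r0 / 2) 2^-1).
have rgt0 : 0 < r by rewrite !lt_min powR_gt0 //= divr_gt0 //= invr_gt0 ltr0n.
have r1 : r < 1.
  by apply: (@le_lt_trans _ _ 2^-1); [rewrite /r !ge_min lexx !orbT|lra].
have rr0 : r < r0.
  by apply: (@le_lt_trans _ _ (r0 / 2)); [rewrite /r !ge_min lexx !orbT|lra].
have rth : r `^ theta / r = r `^ (- (1 - theta)).
  exact: powRB_id.
have yr : y <= r `^ theta / r.
  rewrite rth powRN -[leLHS]invrK lef_pV2 ?posrE ?invr_gt0 ?powR_gt0 //.
  have -> : y^-1 = (y `^ (- (1 - theta)^-1)) `^ (1 - theta).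
    by rewrite -powRrM mulNr mulVf ?powR_inv1 ?ltW //; lra.
  apply: ge0_ler_powR; rewrite ?nnegrE ?powR_ge0 //; [lra|exact: ltW|].
  by rewrite /r ge_min lexx.
have rt0 : 0 < r `^ theta / r by rewrite divr_gt0 ?powR_gt0.
have [|x Fx xF] := rF r; first by rewrite rgt0.
have := CP r x; rewrite rgt0 r1 => /(_ isT Fx).
move=> /(le_trans (covering_number_ge xF)); rewrite lee_fin.
have -> : s = al + (s - al) by lra.
rewrite gt0_powRD //.
rewrite mulrCA [C * _]mulrC ler_pM2l ?powR_gt0 //.
apply/negP; rewrite -ltNge.
have : y `^ (s - al) <= (r `^ theta / r) `^ (s - al).
  by apply: ge0_ler_powR; rewrite ?nnegrE ?(ltW y0) ?(ltW rt0) //; lra.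
rewrite /y -powRrM mulVf ?subr_eq0 ?(gt_eqF als) // powRr1 ?(ltW Cc) //.
rewrite -(ler_pM2l c0) mulrDr mulrCA divff ?gt_eqF // !mulr1; lra.
Qed.

End Criteria.

(** * Monotone pieces of a quarter turn *)

Section QuarterTurn.
Context {R : realType}.
Implicit Types (a b o t x : R).

(** The function sin x - x cos x vanishes at 0 and has derivative x sin x. *)
Lemma mulr_cos_le_sin x : 0 <= x <= pi / 2 -> x * cos x <= sin x.
Proof.
move=> /andP[x0 xpi].
have dF t : is_derive t 1 (fun t => sin t - t * cos t : R) (t * sin t).
  by apply: is_derive_eq; rewrite !scaler1 /GRing.scale /=; ring.
have := @ger0_derive1_ndecr R (fun t => sin t - t * cos t) 0 (pi / 2) _ _ _ 0 x
  (lexx 0) x0 xpi.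
rewrite sin0 mul0r subrr subr_ge0; apply.
- by move=> t _; have [] := dF t.
- move=> t; rewrite in_itv /= => /andP[t0 t1]; rewrite derive1E derive_val.
  by rewrite mulr_ge0 ?ltW // sin_gt0_pihalf // t0.
- apply: continuous_subspaceT => t; apply: differentiable_continuous.
  by apply/derivable1_diffP; have [] := dF t.
Qed.

(** The derivative is factored so that its sign is that of t cos (t - o) - b sin (t - o). *)
Lemma is_derive_damped_sin b o t : 0 < t ->
  is_derive t 1 (fun t => t `^ (- b) * sin (t - o))
    (t `^ (- b - 1) * (t * cos (t - o) - b * sin (t - o))).
Proof.
move=> t0; have dp := is_derive1_powR (- b) t0.
have ds : is_derive t 1 (fun t => sin (t - o)) (cos (t - o)).
  by apply: is_derive_eq; rewrite /GRing.scale /= subr0 mulr1.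
have := is_deriveM dp ds => dps; apply: is_derive_eq.
rewrite /GRing.scale /=.
have -> : t `^ (- b) = t `^ (- b - 1) * t.
  rewrite -[X in _ = _ * X](powRr1 (ltW t0)) -gt0_powRD //.
  by congr (_ `^ _); ring.
by ring.
Qed.

Lemma damped_sin_ndecr b o t1 t2 : 0 < t1 -> t1 <= t2 ->
  (forall t, t1 < t < t2 -> b * sin (t - o) <= t * cos (t - o)) ->
  t1 `^ (- b) * sin (t1 - o) <= t2 `^ (- b) * sin (t2 - o).
Proof.
move=> t10 t12 h.
apply: (@ger0_derive1_ndecr R (fun t => t `^ (- b) * sin (t - o)) t1 t2) => //.
- move=> t; rewrite in_itv /= => /andP[tt _].
  by have [] := is_derive_damped_sin b o (lt_trans t10 tt).
- move=> t; rewrite in_itv /= => /andP[tt tt2].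
  have dd := is_derive_damped_sin b o (lt_trans t10 tt).
  by rewrite derive1E derive_val mulr_ge0 ?powR_ge0 // subr_ge0 h // tt.
- apply: derivable_within_continuous => t; rewrite in_itv /= => /andP[tt _].
  by have [] := is_derive_damped_sin b o (lt_le_trans t10 tt).
Qed.

Lemma damped_sin_nincr b o t1 t2 : 0 < t1 -> t1 <= t2 ->
  (forall t, t1 < t < t2 -> t * cos (t - o) <= b * sin (t - o)) ->
  t2 `^ (- b) * sin (t2 - o) <= t1 `^ (- b) * sin (t1 - o).
Proof.
move=> t10 t12 h.
apply: (@ler0_derive1_nincr R (fun t => t `^ (- b) * sin (t - o)) t1 t2) => //.
- move=> t; rewrite in_itv /= => /andP[tt _].
  by have [] := is_derive_damped_sin b o (lt_trans t10 tt).
- move=> t; rewrite in_itv /= => /andP[tt tt2].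
  have dd := is_derive_damped_sin b o (lt_trans t10 tt).
  by rewrite derive1E derive_val mulr_ge0_le0 ?powR_ge0 // subr_le0 h // tt.
- apply: derivable_within_continuous => t; rewrite in_itv /= => /andP[tt _].
  by have [] := is_derive_damped_sin b o (lt_le_trans t10 tt).
Qed.

Lemma sin_ge0_pihalf x : 0 <= x <= pi / 2 -> 0 <= sin x.
Proof.
move=> /andP[x0 x1]; apply: sin_ge0_pi; rewrite x0 /=.
by apply: (le_trans x1); have := pi_ge0 R; lra.
Qed.

Lemma cos_nincr_pihalf x y : 0 <= x -> x <= y -> y <= pi / 2 -> cos y <= cos x.
Proof.
move=> x0 xy ypi; rewrite le_eqVlt; have [->|ne] := eqVneq x y; first by rewrite eqxx.
have pi0 := pi_ge0 R.
have xi : x \in `[0, pi] by rewrite in_itv /= x0 /=; lra.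
have yi : y \in `[0, pi] by rewrite in_itv /=; apply/andP; split; lra.
by rewrite (ltr_cos xi yi) lt_neqAle ne xy orbT.
Qed.

Lemma damped_cos_nincr a o t1 t2 : 0 <= a -> 0 < t1 -> o <= t1 -> t1 <= t2 ->
  t2 <= o + pi / 2 ->
  t2 `^ (- a) * cos (t2 - o) <= t1 `^ (- a) * cos (t1 - o).
Proof.
move=> a0 t10 ot1 t12 t2o; apply: ler_pM; rewrite ?powR_ge0 //.
- by apply: cos_ge0_pihalf; have := pi_ge0 R; lra.
- rewrite !powRN lef_pV2 ?posrE ?powR_gt0 //; last exact: lt_le_trans t12.
  by apply: ge0_ler_powR; rewrite ?nnegrE //; lra.
- by apply: cos_nincr_pihalf; lra.
Qed.

(* [t cot (t - o)] is nonincreasing on the quarter turn, so [t^-b sin (t - o)]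
   increases up to one critical point and decreases afterwards. *)
Lemma damped_sin_critical b o t1 t2 : 1 <= t1 -> o <= t1 -> t1 <= t2 ->
  t2 <= o + pi / 2 ->
  b * sin (t2 - o) <= t2 * cos (t2 - o) -> b * sin (t1 - o) <= t1 * cos (t1 - o).
Proof.
move=> t11 ot1 t12 t2o h.
have [->//|ne] := eqVneq t1 t2.
have lt12 : t1 < t2 by rewrite lt_neqAle ne.
have s0 : 0 <= sin (t1 - o) by apply: sin_ge0_pihalf; lra.
have s20 : 0 < sin (t2 - o).
  by apply: sin_gt0_pi; have := pi_gt0 R; lra.
(* This compares t cot (t - o) at both ends without dividing. By the formula for sin D it amounts to
   D cos (t2 - o) sin (t1 - o) <= t1 sin D, which follows from D cos D <= sin D and t1 >= 1. *)
have key : t2 * cos (t2 - o) * sin (t1 - o) <= t1 * cos (t1 - o) * sin (t2 - o).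
  set D := t2 - t1.
  have sD : sin D = sin (t2 - o) * cos (t1 - o) - cos (t2 - o) * sin (t1 - o).
    by rewrite -sinB; congr sin; rewrite /D; ring.
  have DsD : D * cos D <= sin D by apply: mulr_cos_le_sin; rewrite /D; lra.
  have cD : cos (t2 - o) <= cos D.
    by apply: cos_nincr_pihalf; rewrite /D; lra.
  have c20 : 0 <= cos (t2 - o) by apply: cos_ge0_pihalf; have := pi_ge0 R; lra.
  have D0 : 0 <= D by rewrite /D; lra.
  have sD0 : 0 <= sin D by apply: sin_ge0_pihalf; rewrite /D; lra.
  have : D * (cos (t2 - o) * sin (t1 - o)) <= sin D.
    apply: le_trans DsD; rewrite ler_wpM2l //; apply: le_trans cD.
    by rewrite ler_piMr // sin_le1.
  have : sin D <= t1 * sin D by rewrite ler_peMl.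
  have -> : t2 = t1 + D by rewrite /D; ring.
  rewrite sD; have -> : t1 + D - o = t2 - o by rewrite /D; ring.
  nra.
rewrite -(ler_pM2r s20); apply: le_trans key.
by rewrite mulrAC ler_wpM2r.
Qed.

(** Here [f] is nonincreasing, and [g] is monotone on each side of its critical point. Hence g - f
    before it and - g - f after it are nondecreasing, dominate the increments of both coordinates
    and vary within an interval of length 4W, so each half costs 8W/r + 1 cubes. The free centre
    [(f0, g0)] allows windows around the origin or around the centre of a ball. *)
Lemma cubes_suffice_quarter n (z : R -> 'rV[R]_n) (D : set R) a b o f0 g0 W r :
  0 <= a -> 0 < r -> 0 <= W ->
  let f t := t `^ (- a) * cos (t - o) in
  let g t := t `^ (- b) * sin (t - o) in
  (forall t, D t -> [/\ 1 <= t, o <= t, t <= o + pi / 2,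
     `|f t - f0| <= W & `|g t - g0| <= W]) ->
  (forall t t' j, `|z t 0 j - z t' 0 j| <= `|f t - f t'| \/
     `|z t 0 j - z t' 0 j| <= `|g t - g t'|) ->
  cubes_suffice r (z @` D) (16 * W / r + 2).
Proof.
move=> a0 r0 W0 f g DP zfg.
(* [P t] says that [g] has nonnegative derivative at [t]. *)
pose P t := b * sin (t - o) <= t * cos (t - o).
have wlog_le (E : set R) (u : R -> R) :
    (forall t t', E t -> E t' -> t <= t' ->
       `|f t - f t'| <= u t' - u t /\ `|g t - g t'| <= u t' - u t) ->
    forall t t' j, E t -> E t' -> `|z t 0 j - z t' 0 j| <= `|u t - u t'|.
  move=> h t t' j Et Et'; have [tt'|/ltW tt'] := leP t t'.
    have [h1 h2] := h _ _ Et Et' tt'.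
    rewrite [leRHS]distrC; apply: le_trans (ler_norm _).
    by case: (zfg t t' j) => /le_trans; apply.
  have [h1 h2] := h _ _ Et' Et tt'.
  apply: le_trans (ler_norm _).
  by case: (zfg t t' j) => /le_trans; apply; rewrite distrC.
have fdec t t' : D t -> D t' -> t <= t' -> f t' <= f t.
  move=> /DP[t1 ot _ _ _] /DP[_ _ t'o _ _] tt'.
  by apply: damped_cos_nincr; lra.
have up : cubes_suffice r (z @` (D `&` [set t | P t])) (2 * (4 * W) / r + 1).
  apply: (@cubes_suffice_dominated _ _ _ _ _ (fun t => g t - f t) (g0 - f0 - 2 * W)) => //.
  - by rewrite mulr_ge0.
  - move=> t [/DP[_ _ _]]; rewrite !ler_norml => /andP[h1 h2] /andP[h3 h4] _.
    by apply/andP; split; lra.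
  - apply: wlog_le => t t' [Dt Pt] [Dt' Pt'] tt'.
    have ff := fdec _ _ Dt Dt' tt'.
    have gg : g t <= g t'.
      have [t1 ot _ _ _] := DP _ Dt; have [_ _ t'o _ _] := DP _ Dt'.
      apply: damped_sin_ndecr => //; first lra.
      (* Intermediate points may lie outside [D]; the sign of the derivative is carried back to them
         from [t']. *)
      move=> x /andP[tx xt']; apply: damped_sin_critical Pt'; lra.
    by rewrite (ger0_norm (_ : 0 <= f t - f t')) ?(ler0_norm (_ : g t - g t' <= 0)); lra.
have down : cubes_suffice r (z @` (D `&` [set t | ~ P t])) (2 * (4 * W) / r + 1).
  apply: (@cubes_suffice_dominated _ _ _ _ _ (fun t => - g t - f t) (- g0 - f0 - 2 * W)) => //.
  - by rewrite mulr_ge0.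
  - move=> t [/DP[_ _ _]]; rewrite !ler_norml => /andP[h1 h2] /andP[h3 h4] _.
    by apply/andP; split; lra.
  - apply: wlog_le => t t' [Dt Pt] [Dt' Pt'] tt'.
    have ff := fdec _ _ Dt Dt' tt'.
    have gg : g t' <= g t.
      have [t1 ot _ _ _] := DP _ Dt; have [_ _ t'o _ _] := DP _ Dt'.
      apply: damped_sin_nincr => //; first lra.
      move=> x /andP[tx xt']; rewrite leNgt; apply/negP => /ltW h; apply: Pt.
      apply: damped_sin_critical h; lra.
    by rewrite (ger0_norm (_ : 0 <= f t - f t')) ?(ger0_norm (_ : 0 <= g t - g t')); lra.
apply: cubes_suffice_le (cubes_sufficeU up down).
  move=> _ [t Dt <-]; have [Pt|Pt] := pselect (P t).
    by left; exists t.
  by right; exists t.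
by rewrite !mulrA; lra.
Qed.

(** Each shift by pi/2 exchanges sine and cosine up to sign, which reduces every quarter turn to the
    first one. *)
Lemma cos_sin_quarter (m : nat) : exists e e' : R, [/\ `|e| = 1, `|e'| = 1 &
  (forall t, cos t = e * cos (t - m%:R * (pi / 2)) /\
             sin t = e' * sin (t - m%:R * (pi / 2))) \/
  (forall t, cos t = e * sin (t - m%:R * (pi / 2)) /\
             sin t = e' * cos (t - m%:R * (pi / 2)))].
Proof.
elim: m => [|m [e [e' [e1 e'1 h]]]].
  by exists 1, 1; rewrite normr1; split=> //; left => t; rewrite mul0r subr0 !mul1r.
have E t : t - m.+1%:R * (pi / 2) = t - m%:R * (pi / 2) - pi / 2.
  by rewrite -natr1; ring.
case: h => h.
  exists (- e), e'; rewrite normrN; split=> //; right => t.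
  by have [-> ->] := h t; rewrite E sinBpihalf cosBpihalf mulrNN.
exists e, (- e'); rewrite normrN; split=> //; left => t.
by have [-> ->] := h t; rewrite E sinBpihalf cosBpihalf mulrNN.
Qed.

End QuarterTurn.

(** * Covering the spiral in a ball *)

Section PowerSums.
Context {R : realType}.
Implicit Types (x y b : R).

(** From (y/x)^b >= 1 + b ln (y/x) and ln (y/x) >= 1 - x/y. It serves both the power sums and the
    gaps between turns. *)
Lemma powR_tangent x y b : 0 < x -> 0 < y -> 0 <= b ->
  x `^ b * (1 + b * (1 - x / y)) <= y `^ b.
Proof.
move=> x0 y0 b0; have yx0 : 0 < y / x by rewrite divr_gt0.
have -> : y = x * (y / x) by rewrite mulrCA divff ?mulr1 // gt_eqF.
rewrite powRM ?(ltW x0) ?(ltW yx0) // ler_pM2l ?powR_gt0 //.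
have -> : x / (x * (y / x)) = (y / x)^-1.
  by rewrite invfM mulrA divff ?mul1r // gt_eqF.
rewrite -[(y / x) `^ b]lnK ?posrE ?powR_gt0 // ln_powR.
apply: le_trans (expR_ge1Dx _); rewrite lerD2l ler_wpM2l //.
have i0 : 0 < (y / x)^-1 by rewrite invr_gt0.
have := @le_ln1Dx R ((y / x)^-1 - 1); rewrite addrCA subrr addr0 lnV //.
by move=> h; have := h _; lra.
Qed.

(** A discrete form of integrating x^(b - 1). The tangent inequality gives (n+1)^b - n^b >= b n^b /
    (n+1); replacing n^b by (n+1)^b costs the factor 2. *)
Lemma sum_powR_le b (M : nat) : 0 < b <= 1 ->
  \sum_(m < M) (m.+1%:R : R) `^ (b - 1) <= 2 / b * M%:R `^ b.
Proof.
move=> /andP[b0 b1]; elim: M => [|n IH].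
  by rewrite big_ord0 mulr_ge0 ?powR_ge0 ?divr_ge0 // ltW.
rewrite big_ord_recr /=.
(* The tangent inequality needs a positive base point, so the first term is checked directly. *)
have [->|n0] := posnP n.
  rewrite big_ord0 add0r !powR1 mulr1 ler_pdivlMr //; lra.
apply: le_trans (_ : 2 / b * n%:R `^ b + n.+1%:R `^ (b - 1) <= _); first by rewrite lerD2r.
have nn : 0 < n%:R :> R by rewrite ltr0n.
have n1 : 0 < n.+1%:R :> R by rewrite ltr0n.
have tg := @powR_tangent n%:R n.+1%:R b nn n1 (ltW b0).
have double : n.+1%:R `^ b <= 2 * n%:R `^ b.
  apply: (@le_trans _ _ ((2 * n%:R) `^ b)).
    apply: ge0_ler_powR; rewrite ?nnegrE ?mulr_ge0 //; first exact: ltW.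
    have n2 : 1 <= n%:R :> R by rewrite ler1n.
    by rewrite -[n.+1%:R]natr1; lra.
  by rewrite powRM // ler_wpM2r ?powR_ge0 // ler1_powR // ler1n.
have -> : n.+1%:R `^ (b - 1) = n.+1%:R `^ b / n.+1%:R :> R.
  by rewrite gt0_powRD // powRN powRr1 // ltW.
have e1 : 1 - n%:R / n.+1%:R = n.+1%:R^-1 :> R.
  by rewrite -[n.+1%:R]natr1; field; rewrite natr1 gt_eqF.
rewrite e1 in tg.
rewrite -lerBrDl -mulrBr.
apply: (@le_trans _ _ (2 / b * (n%:R `^ b * (b / n.+1%:R)))); last first.
  by rewrite ler_wpM2l //; [rewrite divr_ge0 // ltW|rewrite lerBrDl -[X in X + _]mulr1 -mulrDr].
have -> : 2 / b * (n%:R `^ b * (b / n.+1%:R)) = 2 * n%:R `^ b / n.+1%:R :> R.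
  by field; rewrite gt_eqF ?gt_eqF // lt0r_neq0.
by rewrite ler_pM2r ?invr_gt0.
Qed.

End PowerSums.

Definition spiral_point (R : realType) (p q t : R) : 'rV[R]_2 :=
  plane_of_complex (Complex (t `^ (- p) * cos t) (t `^ (- q) * sin t)).

Local Notation spiral p q := (spiral_point p q @` [set t | (1 < t)%R]).

Section UpperBound.
Context {R : realType}.
Implicit Types (p q t r rho : R).

Lemma spiral_point0 p q t : spiral_point p q t 0 0 = t `^ (- p) * cos t.
Proof. by rewrite mxE. Qed.

Lemma spiral_point1 p q t : spiral_point p q t 0 1 = t `^ (- q) * sin t.
Proof. by rewrite mxE. Qed.

Lemma elliptical_spiralE p q :
  @plane_of_complex R @` elliptical_spiral p q =
  spiral p q.
Proof.
rewrite eqEsubset; split=> [_ [_ [t t1 <-] <-]|_ [t t1 <-]]; first by exists t.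
by eexists; first by exists t; [exact: t1|].
Qed.

Lemma ord2P (j : 'I_2) : j = 0 \/ j = 1.
Proof. by case: j => -[|[|//]] ?; [left|right]; apply/val_inj. Qed.

Lemma coord_le_eucl_dist (n : nat) (x y : 'rV[R]_n) j :
  `|x 0 j - y 0 j| <= eucl_dist x y.
Proof.
rewrite -sqrtr_sqr ler_wsqrtr // (bigD1 j) //= lerDl.
by apply: sumr_ge0 => i _; rewrite sqr_ge0.
Qed.

Lemma powRN_le_gt0 p t t' : 0 <= p -> 0 < t -> t <= t' -> t' `^ (- p) <= t `^ (- p).
Proof.
move=> p0 t0 tt'; rewrite !powRN lef_pV2 ?posrE ?powR_gt0 ?(lt_le_trans t0) //.
by apply: ge0_ler_powR; rewrite ?nnegrE //; lra.
Qed.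

Lemma spiral_point_le p q t j : 0 <= p <= q -> 1 <= t ->
  `|spiral_point p q t 0 j| <= t `^ (- p).
Proof.
move=> /andP[p0 pq] t1; have [->|->] := ord2P j.
  by rewrite spiral_point0 normrM ger0_norm ?powR_ge0 // ler_piMr ?powR_ge0 ?cos_max.
rewrite spiral_point1 normrM ger0_norm ?powR_ge0 //.
apply: (@le_trans _ _ (t `^ (- q))); first by rewrite ler_piMr ?powR_ge0 ?sin_max.
by apply: ler_powR => //; rewrite lerN2.
Qed.

(** The signs of the quarter turn are moved onto the window centre [y]. On quarter turns where sine
    and cosine are exchanged, the exponents [p] and [q] exchange roles. *)
Lemma cubes_suffice_spiral_quarter p q r W (m : nat) (E : set 'rV[R]_2)
    (y : 'rV[R]_2) : 0 <= p <= q -> 0 < r -> 0 <= W ->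
  (forall z, E z -> exists t, [/\ spiral_point p q t = z, 1 <= t &
     m%:R * (pi / 2) <= t <= m%:R * (pi / 2) + pi / 2]) ->
  (forall z j, E z -> `|z 0 j - y 0 j| <= W) ->
  cubes_suffice r E (16 * W / r + 2).
Proof.
move=> /andP[p0 pq] r0 W0 Esp EW.
pose D := [set t | [/\ E (spiral_point p q t), 1 <= t &
   m%:R * (pi / 2) <= t <= m%:R * (pi / 2) + pi / 2]].
apply: (@cubes_suffice_le _ _ (spiral_point p q @` D)) (lexx _) _.
  by move=> z Ez; have [t [tz t1 tm]] := Esp z Ez; exists t => //; split=> //; rewrite tz.
have [e [e' [e1 e'1]]] := @cos_sin_quarter R m.
have eK (u v c : R) : `|c| = 1 -> `|u - c * v| = `|c * u - v|.
  move=> c1; have cc : c * c = 1 by rewrite -expr2 -real_normK ?num_real // c1 expr1n.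
  rewrite -[RHS]mul1r -c1 -normrM; congr `|_|; rewrite mulrBr mulrA cc; ring.
have dist c (u v : R) : `|c| = 1 -> `|c * u - c * v| = `|u - v|.
  by move=> c1; rewrite -mulrBr normrM c1 mul1r.
case=> cs.
  apply: (@cubes_suffice_quarter _ _ _ _ p q (m%:R * (pi / 2)) (e * y 0 0) (e' * y 0 1)) => //.
    move=> t [Et t1 /andP[mt tm]]; split => //; rewrite distrC -eK // distrC.
      by have := EW _ 0 Et; rewrite spiral_point0 (cs t).1 mulrCA.
    by have := EW _ 1 Et; rewrite spiral_point1 (cs t).2 mulrCA.
  move=> t t' j; have [->|->] := ord2P j; [left|right].
    by rewrite !spiral_point0 (cs t).1 (cs t').1 !(mulrCA _ e) dist.
  by rewrite !spiral_point1 (cs t).2 (cs t').2 !(mulrCA _ e') dist.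
apply: (@cubes_suffice_quarter _ _ _ _ q p (m%:R * (pi / 2)) (e' * y 0 1) (e * y 0 0)) => //.
- exact: le_trans pq.
- move=> t [Et t1 /andP[mt tm]]; split => //; rewrite distrC -eK // distrC.
    by have := EW _ 1 Et; rewrite spiral_point1 (cs t).2 mulrCA.
  by have := EW _ 0 Et; rewrite spiral_point0 (cs t).1 mulrCA.
- move=> t t' j; have [->|->] := ord2P j; [right|left].
    by rewrite !spiral_point0 (cs t).1 (cs t').1 !(mulrCA _ e) dist.
  by rewrite !spiral_point1 (cs t).2 (cs t').2 !(mulrCA _ e') dist.
Qed.

Lemma cubes_suffice_ball r rho (E : set 'rV[R]_2) (x : 'rV[R]_2) :
  0 < r -> r <= rho ->
  cubes_suffice r (eucl_ball x rho `&` E) (9 * (rho / r) ^+ 2).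
Proof.
move=> r0 rr; have rho0 : 0 <= rho by lra.
apply: cubes_suffice_le (@cubes_suffice_rect R (eucl_ball x rho `&` E)
   (x 0 0 - rho) (x 0 1 - rho) (2 * rho) (2 * rho) r _ _ _ _) => //.
(* The count (2x + 1)^2 is at most 9 x^2 for x = rho/r >= 1. *)
- have : 1 <= rho / r by rewrite ler_pdivlMr // mul1r.
  by rewrite -!mulrA; nra.
- by rewrite mulr_ge0.
- by rewrite mulr_ge0.
- move=> y [xy _].
  have := le_trans (coord_le_eucl_dist x y 0) xy; rewrite ler_norml => /andP[? ?].
  have := le_trans (coord_le_eucl_dist x y 1) xy; rewrite ler_norml => /andP[? ?].
  by split; lra.
Qed.

(* [kappa] is the number of turns after which consecutive turns are closer than
   r in the vertical direction; beyond it a full rectangle is covered. *)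
Lemma cubes_suffice_spiral p q a H r rho (x : 'rV[R]_2) :
  0 < p <= q -> 0 <= a < 1 -> 0 < r < 1 -> r <= rho ->
  (forall t, 1 <= t -> Num.min (t `^ (- p)) rho <= H * t `^ (- a)) ->
  let kappa := r `^ (- (1 + q)^-1) in
  cubes_suffice r (eucl_ball x rho `&` spiral p q)
    ((64 * 2 `^ p / (1 - a) + 13) * (H * kappa `^ (1 - a) / r)).
Proof.
move=> /andP[p0 pq] /andP[a0 a1] /andP[r0 r1] rr minH kappa.
set F := spiral_point p q @` _.
have q0 : 0 < q by lra.
have r01 : 0 < r <= 1 by rewrite r0 ltW.
have p0q : 0 <= p <= q by rewrite ltW.
have k0 : 0 < kappa by rewrite powR_gt0.
have k1 : 1 <= kappa.
  rewrite -(powRr0 r) /kappa ger_powR // lerNl oppr0 invr_ge0; lra.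
(* Since kappa^(1 + q) = 1/r, the turns beyond [kappa] have height at most r kappa. *)
have kq : kappa `^ (- q) = r * kappa.
  transitivity (r `^ 1 * kappa); last by rewrite powRr1 // ltW.
  rewrite /kappa -powRrM -gt0_powRD //.
  by congr (_ `^ _); field; lra.
have kpr : r <= kappa `^ (- p).
  apply: (@le_trans _ _ (kappa `^ (- q))); last by apply: ler_powR => //; lra.
  by rewrite kq ler_peMr // ltW.
set X := Num.min (kappa `^ (- p)) rho.
have Xr : r <= X by rewrite le_min kpr.
have XH : X <= H * kappa `^ (- a) by apply: minH.
have H0 : 0 < H.
  have := lt_le_trans r0 (le_trans Xr XH); rewrite pmulr_lgt0 // powR_gt0 //.
(* [Z] is the common unit in which all parts of the cover are measured. *)
set Z := H * kappa `^ (1 - a) / r.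
have Zk : H * kappa `^ (- a) * kappa / r = Z.
  by rewrite /Z addrC gt0_powRD // (powRr1 (ltW k0)) !mulrA.
set M := (Num.truncn kappa).+1.
have [M1 M2] : kappa <= M%:R /\ M%:R <= 2 * kappa.
  have /andP[h1 h2] := truncn_itv (ltW k0).
  by split; [exact: ltW|rewrite /M -natr1; lra].
pose Q m := [set z | (eucl_ball x rho `&` F) z /\
   exists t, [/\ spiral_point p q t = z, 1 <= t &
     m%:R * (pi / 2) <= t <= m%:R * (pi / 2) + pi / 2]].
pose T := [set z | (eucl_ball x rho `&` F) z /\
   exists t, [/\ spiral_point p q t = z, 1 <= t &
     kappa <= t]].
(* On quarter turn number m one has t >= (m+1)/2, hence the factor 2^p in the window size. *)
pose W m := 2 `^ p * (H * (m.+1%:R) `^ (- a)) : R.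
have W0 m : 0 <= W m by rewrite /W mulr_ge0 ?powR_ge0 // mulr_ge0 ?powR_ge0 // ltW.
have pi2 : 1 <= pi / 2 :> R := pihalf_ge1 R.
have QM m : cubes_suffice r (Q m) (16 * W m / r + 2).
  have mt0 : forall t : R, 1 <= t -> m%:R * (pi / 2) <= t ->
      t `^ (- p) <= 2 `^ p * m.+1%:R `^ (- p).
    move=> t t1 mt; have m0 : 0 <= m%:R :> R by rewrite ler0n.
    have mt' : m.+1%:R <= 2 * t by rewrite -natr1; nra.
    rewrite powRN [in leRHS]powRN ler_pdivlMr ?powR_gt0 ?ltr0n //.
    rewrite ler_pdivrMl ?powR_gt0 //; last lra.
    rewrite mulrC -powRM //; last lra.
    by clear -p0 t1 mt'; apply: ge0_ler_powR; rewrite ?nnegrE ?ler0n //; lra.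
  have := minH m.+1%:R; rewrite ler1n => /(_ isT).
  (* The window is centred at the origin when the turn is narrower than the ball, and at [x]
     otherwise. *)
  have [c|c] := leP (m.+1%:R `^ (- p)) rho => minm.
    apply: (@cubes_suffice_spiral_quarter p q r (W m) m _ 0) => //.
      by move=> z [].
    move=> z j [_ [t [<- t1 /andP[mt tm]]]]; rewrite [X in _ - X]mxE subr0.
    apply: le_trans (spiral_point_le _ p0q t1) _; apply: le_trans (mt0 _ t1 mt) _.
    by rewrite ler_wpM2l ?powR_ge0.
  apply: (@cubes_suffice_spiral_quarter p q r (W m) m _ x) => //.
    by move=> z [].
  move=> z j [[xz _] _]; rewrite distrC.
  apply: le_trans (coord_le_eucl_dist _ _ _) _; apply: le_trans xz _.
  apply: le_trans minm _; rewrite ler_peMl //.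
    by rewrite mulr_ge0 ?powR_ge0 // ltW.
  by rewrite -[leLHS](powRr0 2); apply: ler_powR; rewrite ?ler1n // ltW.
have TM : cubes_suffice r T (9 * Z).
  have key c : (forall z, T z -> `|z 0 0 - c| <= X) -> cubes_suffice r T (9 * Z).
    move=> Tc; have kq0 : 0 <= kappa `^ (- q) by rewrite powR_ge0.
    apply: cubes_suffice_le (@cubes_suffice_rect R T (c - X) (- kappa `^ (- q))
      (2 * X) (2 * kappa `^ (- q)) r _ _ _ _) => //; [|lra|lra|].
    - have -> : 2 * kappa `^ (- q) / r = 2 * kappa.
        by rewrite kq; field; rewrite gt_eqF.
      have : 1 <= X / r by rewrite ler_pdivlMr // mul1r.
      have : X / r * kappa <= Z.
        by rewrite -Zk mulrAC ler_pM2r ?invr_gt0 // ler_pM2r.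
      by rewrite -mulrA; nra.
    - move=> z Tz; have := Tc _ Tz; rewrite ler_norml => /andP[? ?]; split; first lra.
      case: Tz => _ [t [<- t1 kt]]; rewrite spiral_point1.
      have : `|t `^ (- q) * sin t| <= kappa `^ (- q).
        rewrite normrM ger0_norm ?powR_ge0 //.
        apply: (@le_trans _ _ (t `^ (- q))); first by rewrite ler_piMr ?powR_ge0 ?sin_max.
        by apply: powRN_le_gt0 => //; exact: ltW.
      by rewrite ler_norml => /andP[? ?]; lra.
  have [c|c] := leP (kappa `^ (- p)) rho.
    apply: (key 0) => z [_ [t [<- t1 kt]]]; rewrite subr0 /X min_l //.
    apply: le_trans (spiral_point_le _ p0q t1) _.
    by apply: powRN_le_gt0 => //; exact: ltW.
  apply: (key (x 0 0)) => z [[xz _] _]; rewrite /X min_r ?(ltW c) // distrC.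
  exact: le_trans (coord_le_eucl_dist _ _ _) xz.
apply: cubes_suffice_le (cubes_sufficeU (cubes_suffice_sum (M := M) (fun m _ => QM m)) TM).
  move=> z [xz Fz]; have [t /= t1 tz] := Fz.
  have pi20 : 0 < pi / 2 :> R by lra.
  have tp0 : 0 <= t / (pi / 2) by rewrite divr_ge0 //; lra.
  (* The integer part of t/(pi/2) is the quarter containing t; if it is at least [M], then t >=
     kappa and the point lies in the tail [T]. *)
  have := truncn_itv tp0; set m := Num.truncn _ => /andP[m1 m2].
  have [mM|Mm] := ltnP m M.
    left; exists m => //; split => //; exists t; split=> //; first exact: ltW.
    rewrite -ler_pdivlMr // m1 /=; move: m2.
    by rewrite ltr_pdivrMr // -natr1 mulrDl mul1r => /ltW.
  right; split => //; exists t; split=> //; first exact: ltW.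
  apply: (le_trans M1).
  apply: (@le_trans _ _ m%:R); first by rewrite ler_nat.
  move: m1; rewrite ler_pdivlMr // => h; apply: le_trans h.
  by rewrite ler_peMr.
rewrite big_split /= sumr_const card_ord -mulr_suml -mulr_sumr /W -!mulr_sumr.
have S := @sum_powR_le R (1 - a) M; have {S} := S _.
have -> : 1 - a - 1 = - a by ring.
set S := \sum_(_ < _) _ => /(_ _) SM.
have {SM} SM : S <= 2 / (1 - a) * M%:R `^ (1 - a) by apply: SM; lra.
have MM : M%:R `^ (1 - a) <= 2 * kappa `^ (1 - a).
  apply: (@le_trans _ _ ((2 * kappa) `^ (1 - a))).
    by clear -a1 k0 M2; apply: ge0_ler_powR; rewrite ?nnegrE ?mulr_ge0 //; lra.
  rewrite powRM //; last exact: ltW.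
  by clear -a0; rewrite ler_wpM2r ?powR_ge0 // ler1_powR //; lra.
have S2 : S <= 4 / (1 - a) * kappa `^ (1 - a).
  apply: (le_trans SM); apply: (@le_trans _ _ (2 / (1 - a) * (2 * kappa `^ (1 - a)))).
    by clear -MM a1; rewrite ler_wpM2l // divr_ge0 //; lra.
  by clear; rewrite mulrA; lra.
(* The additive 2 of each quarter totals 2M <= 4 kappa <= 4Z; with 9Z for the tail this gives the
   constant 13. *)
have kZ : kappa <= Z.
  rewrite -Zk mulrAC ler_peMl ?(ltW k0) // ler_pdivlMr // mul1r.
  exact: le_trans Xr XH.
have c0 : 0 <= 16 * 2 `^ p * H / r.
  by rewrite divr_ge0 ?(ltW r0) // !mulr_ge0 ?powR_ge0 // ltW.
have := ler_wpM2l c0 S2.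
have -> : 16 * 2 `^ p * H / r * (4 / (1 - a) * kappa `^ (1 - a)) = 64 * 2 `^ p / (1 - a) * Z.
  by rewrite /Z; field; rewrite gt_eqF //= subr_eq0 gt_eqF.
have -> : 16 * 2 `^ p * H / r * S = 16 * (2 `^ p * (H * S)) / r
  by rewrite !mulrA; field; rewrite gt_eqF.
rewrite -mulr_natr; lra.
Qed.

End UpperBound.

(** * Separated points on the spiral *)

Section LowerBound.
Context {R : realType}.
Implicit Types (p q t r rho l : R).

(** Pigeonhole: two points in one cube differ by at most r in every coordinate. *)
Lemma separated_card_le (n k : nat) (T : finType) (z : T -> 'rV[R]_n)
    (E : set 'rV[R]_n) r :
  (forall i, E (z i)) ->
  (forall i i', (forall j, `|z i 0 j - z i' 0 j| <= r) -> i = i') ->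
  covered_by E r k -> (#|T| <= k)%N.
Proof.
move=> Ez sep [c cE].
have cz i : exists j, hypercube (c j) r (z i).
  by have [j _ ?] := cE _ (Ez i); exists j.
have [f fP] := boolp.choice cz.
have finj : injective f.
  move=> i i' fi; apply: sep => j.
  have /andP[h1 h2] := fP i j; have /andP[h3 h4] := fP i' j.
  by rewrite fi in h1 h2; rewrite ler_norml; apply/andP; split; lra.
by have := leq_card f finj; rewrite card_ord.
Qed.

Lemma ord_ltn_total (n : nat) (i j : 'I_n) :
  ~ (i < j)%N -> ~ (j < i)%N -> i = j.
Proof.
move=> /negP + /negP; rewrite -!leqNgt => ji ij.
by apply/val_inj/eqP; rewrite eqn_leq ij.
Qed.

Lemma cos_sin_natmul_2pi (n : nat) t :
  cos (n%:R * (2 * pi) + t) = cos t /\ sin (n%:R * (2 * pi) + t) = sin t.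
Proof.
have -> : n%:R * (2 * pi) + t = t + pi *+ 2 *+ n.
  by rewrite -[pi *+ 2 *+ n]mulr_natl -[pi *+ 2]mulr_natl addrC.
by rewrite (periodicn (@cosD2pi R)) (periodicn (@sinD2pi R)).
Qed.

Lemma acos_nincr (x y : R) : -1 <= x -> x <= y -> y <= 1 -> acos y <= acos x.
Proof.
move=> x1 xy y1; have hx : -1 <= x <= 1 by lra.
have hy : -1 <= y <= 1 by lra.
rewrite leNgt; apply/negP => h.
have := @ltr_cos R (acos x) (acos y).
rewrite !in_itv /= !acos_ge0 ?acos_lepi // => /(_ isT isT).
by rewrite h !acosK ?in_itv // ltNge xy.
Qed.

Lemma half_le_sin_acos (c : R) : 0 <= c <= 1 / 2 ->
  1 / 2 <= sin (acos c) /\ sin (acos c) ^+ 2 = 1 - c ^+ 2.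
Proof.
move=> /andP[c0 c1]; have hc : -1 <= c <= 1 by lra.
have c2 : 0 <= 1 - c ^+ 2 by nra.
rewrite sin_acos // sqr_sqrtr //; split=> //.
rewrite -[leLHS]ger0_norm; last by lra.
by rewrite -sqrtr_sqr ler_wsqrtr //; nra.
Qed.

(** The tangent inequality at the reciprocals 1/t' and 1/t. *)
Lemma powRN_gap q t t' : 0 <= q -> 0 < t -> 0 < t' ->
  q * (t' - t) * t' `^ (- (q + 1)) <= t `^ (- q) - t' `^ (- q).
Proof.
move=> q0 t0 t'0; have inv (x : R) : 0 < x -> x^-1 `^ q = x `^ (- q).
  by move=> x0; rewrite -powR_inv1 ?(ltW x0) // -powRrM mulN1r.
have := @powR_tangent R t'^-1 t^-1 q; rewrite !invr_gt0 => /(_ t'0 t0 q0).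
rewrite !inv // invrK mulrDr mulr1 lerBrDl; apply: le_trans.
rewrite lerD2l le_eqVlt; apply/orP; left; apply/eqP.
rewrite opprD gt0_powRD // (powR_inv1 (ltW t'0)).
by field; rewrite gt_eqF.
Qed.

(* A point of a later turn with almost the same abscissa lies lower, by the gap
   between the turns up to an error r. *)
Lemma spiral_turn_gap p q r t t' (c c' s s' : R) :
  0 < p <= q -> 0 < r -> 1 <= t -> t < t' ->
  0 <= c <= 1 / 2 -> 0 <= c' <= 1 / 2 -> 1 / 2 <= s -> 1 / 2 <= s' ->
  s ^+ 2 = 1 - c ^+ 2 -> s' ^+ 2 = 1 - c' ^+ 2 ->
  t `^ (- p) * c - t' `^ (- p) * c' <= r ->
  t `^ (- q) * s - t' `^ (- q) * s' <= r ->
  t `^ (- q) - t' `^ (- q) <= 4 * r.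
Proof.
move=> /andP[p0 pq] r0 t1 tt' /andP[c0 c1] /andP[c'0 c'1] s1 s'1 ss ss' xr yr.
have t0 : 0 < t by lra.
have t'0 : 0 < t' by lra.
have tp0 : 0 < t `^ p by rewrite powR_gt0.
have tpm : t' `^ (- p) <= t `^ (- p) by apply: powRN_le_gt0; lra.
have tqm : t' `^ (- q) <= t `^ (- q) by apply: powRN_le_gt0; lra.
have tqp : t `^ (- q) <= t `^ (- p) by apply: ler_powR; lra.
have tpp : t `^ (- p) * t `^ p = 1 by rewrite -gt0_powRD // addNr powRr0.
have tp'0 : 0 < t `^ (- p) by rewrite powR_gt0.
have cc' : c - c' <= r * t `^ p.
  have : t `^ (- p) * (c - c') <= r.
    have : t' `^ (- p) * c' <= t `^ (- p) * c' by rewrite ler_wpM2r.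
    by rewrite mulrBr; lra.
  rewrite -(ler_pM2r tp0); apply: le_trans.
  by rewrite mulrAC tpp mul1r.
(* Since (s' - s)(s + s') = (c - c')(c + c') and c + c' <= 1 <= s + s', an error in the cosine
   passes to the sine without amplification. *)
have s's : s' <= s + r * t `^ p.
  have rt : 0 <= r * t `^ p by rewrite mulr_ge0 // ltW.
  have [cle|clt] := leP c c'; first by nra.
  have : (s' - s) * (s + s') = (c - c') * (c + c') by nra.
  nra.
have t'q0 : 0 <= t' `^ (- q) by rewrite powR_ge0.
have y' : t' `^ (- q) * s' <= t' `^ (- q) * s + r.
  apply: (@le_trans _ _ (t' `^ (- q) * (s + r * t `^ p))); first by rewrite ler_wpM2l.
  rewrite mulrDr lerD2l mulrCA ler_piMr ?(ltW r0) //.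
  rewrite -tpp ler_wpM2r ?(ltW tp0) //; lra.
nra.
Qed.

(** The condition on [D] makes the vertical gap of turns 2D apart at least 8r up to parameter 28l,
    whereas [spiral_turn_gap] would force it to be at most 4r. *)
Lemma spiral_turns_separated p q r l (D t t' c c' s s' : R) :
  0 < p <= q -> 0 < r -> 1 <= l -> 1 <= D ->
  4 * 28 `^ (q + 1) / q * (r * l `^ (q + 1)) <= D ->
  1 <= t -> t + 2 * D <= t' -> t' <= 28 * l ->
  0 <= c <= 1 / 2 -> 0 <= c' <= 1 / 2 -> 1 / 2 <= s -> 1 / 2 <= s' ->
  s ^+ 2 = 1 - c ^+ 2 -> s' ^+ 2 = 1 - c' ^+ 2 ->
  t `^ (- p) * c - t' `^ (- p) * c' <= r ->
  t `^ (- q) * s - t' `^ (- q) * s' <= r -> False.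
Proof.
move=> pq r0 l1 D1 DC t1 g h4 cP cP' s1 s1' ss ss' close0 close1.
have /andP[p0 p_le_q] := pq; have q0 : 0 < q by lra.
have tlt : t < t' by lra.
have t0 : 0 < t by lra.
have t'0 : 0 < t' by lra.
have l0 : 0 < l by lra.
have h4r := spiral_turn_gap pq r0 t1 tlt cP cP' s1 s1' ss ss' close0 close1.
have tg := powRN_gap (ltW q0) t0 t'0.
have e2 : q * (2 * D) * (28 * l) `^ (- (q + 1)) <= q * (t' - t) * t' `^ (- (q + 1)).
  rewrite ler_pM ?powR_ge0 //.
  - by clear -q0 D1; rewrite !mulr_ge0 //; lra.
  - by rewrite ler_pM2l //; lra.
  - by clear -q0 t'0 h4; apply: powRN_le_gt0; lra.
have e3 : 8 * r <= q * (2 * D) * (28 * l) `^ (- (q + 1)).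
  rewrite powRN -ler_pdivrMr ?invr_gt0 ?powR_gt0 ?mulr_gt0 // invrK.
  rewrite powRM ?(ltW l0) //.
  have := ler_wpM2l (_ : 0 <= 2 * q) DC.
  rewrite mulr_ge0 ?(ltW q0) // => /(_ isT) h.
  rewrite [leRHS](_ : _ = 2 * q * D); last by ring.
  apply: le_trans h; rewrite le_eqVlt; apply/orP; left; apply/eqP.
  by field; rewrite gt_eqF.
by lra.
Qed.

(** On one turn a larger cosine means an earlier parameter, hence a larger factor t^-p; the cosine
    step alone already moves the abscissa by at least 2r. *)
Lemma spiral_arc_separated p r l (t t' c c' : R) :
  0 <= p -> 0 < r -> 0 < l -> 1 <= t' -> t' <= t -> t' <= 28 * l ->
  0 <= c -> c + 2 * (28 `^ p * l `^ p * r) <= c' ->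
  `|t `^ (- p) * c - t' `^ (- p) * c'| <= r -> False.
Proof.
move=> p0 r0 l0 t'1 ttd h4 c0; set w := 2 * _ => cw.
have tp : t `^ (- p) <= t' `^ (- p) by apply: powRN_le_gt0; lra.
have w0 : 0 < w by rewrite /w !mulr_gt0 ?powR_gt0.
have wt : 2 * r <= t' `^ (- p) * w.
  have : (28 * l) `^ (- p) <= t' `^ (- p) by apply: powRN_le_gt0; lra.
  rewrite -(ler_pM2r w0); apply: le_trans.
  rewrite powRN powRM ?(ltW l0) // /w le_eqVlt; apply/orP; left; apply/eqP.
  by field; rewrite !gt_eqF ?powR_gt0.
rewrite ler_norml => /andP[+ _].
have := ler_wpM2r c0 tp.
have t'p0 : 0 <= t' `^ (- p) by rewrite powR_ge0.
by have := ler_wpM2l t'p0 cw; rewrite mulrDr; lra.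
Qed.

(** Successive chosen turns are [d] full turns apart; the angles in [0, pi] cost at most pi, and 2 d
    pi - pi >= d pi >= 2D. *)
Lemma angle_gap (N j j' d a a' D : R) :
  1 <= D -> D <= d -> j + 1 <= j' -> a <= pi -> 0 <= a' ->
  (N + d * j) * (2 * pi) + a + 2 * D <= (N + d * j') * (2 * pi) + a'.
Proof.
move=> D1 Dd jj' api a'0; have pi2 := pi_ge2 R.
have hd : d * (j + 1) <= d * j' by rewrite ler_wpM2l //; lra.
have i1 : 0 <= (d * j' - d * (j + 1)) * pi by apply: mulr_ge0; lra.
have i2 : 0 <= (d - 1) * pi by apply: mulr_ge0; lra.
have i3 : 0 <= d * (pi - 2) by apply: mulr_ge0; lra.
by lra.
Qed.

(** The count behind all lower bounds: about l/(2D) turns times Lam/w points per turn. The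
    parameters [l], [D], [Lam] stay free to be tuned in each range of theta. *)
Lemma spiral_many_separated p q r rho l (D Lam : R) :
  0 < p <= q -> 0 < r -> 1 <= l -> 1 <= D ->
  4 * 28 `^ (q + 1) / q * (r * l `^ (q + 1)) <= D ->
  l `^ (- q) <= rho / 2 -> 0 <= Lam <= 1 / 2 -> Lam * l `^ (- p) <= rho / 2 ->
  exists2 x, (spiral p q) x &
    forall k, covered_by (eucl_ball x rho `&`
                 spiral p q) r k ->
      (4 * 28 `^ p)^-1 * (l / D * (Lam * l `^ (- p) / r)) <= k%:R.
Proof.
move=> /andP[p0 pq] r0 l1 D1 DC lq /andP[L0 L1] Lp.
have q0 : 0 < q by lra.
have l0 : 0 < l by lra.
have D0 : 0 < D by lra.
pose w := 2 * (28 `^ p * l `^ p * r).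
have w0 : 0 < w by rewrite /w !mulr_gt0 ?powR_gt0.
have ceil (x : R) : 1 <= x -> exists m : nat, x <= m%:R <= 2 * x.
  move=> x1; have /andP[h1 h2] := truncn_itv (le_trans ler01 x1).
  by exists (Num.truncn x).+1; rewrite (ltW h2) /= -[leLHS]natr1; lra.
have [N0 /andP[N1 N2]] := ceil l l1; have [d /andP[d1 d2]] := ceil D D1.
have lD0 : 0 <= l / (2 * D) by rewrite divr_ge0 ?mulr_ge0 // ltW.
have Lw0 : 0 <= Lam / w by rewrite divr_ge0 // ltW.
(* The successors make both counts positive and at least the real quotients they truncate. *)
set J := (Num.truncn (l / (2 * D))).+1; set I := (Num.truncn (Lam / w)).+1.
pose kk (j : nat) := (N0 + d * j)%N.
pose cc (i : nat) := i%:R * w.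
(* Prescribing cosines in steps of [w] controls the abscissas. Turn numbers lie in [l, 3l], so 2 <=
   pi <= 4 puts the parameters in [4l, 28l], the origin of the constant 28. *)
pose tt j i := (kk j)%:R * (2 * pi) + acos (cc i).
pose z (m : 'I_J * 'I_I) := spiral_point p q (tt m.1 m.2).
have pi2 := pi_ge2 R.
have pi4 : pi <= 4 :> R by have := pihalf_lt2 R; lra.
have ccP i : (i < I)%N -> 0 <= cc i <= 1 / 2 /\ cc i <= Lam.
  move=> iI; have h : cc i <= Lam.
    rewrite /cc -ler_pdivlMr //; apply: (@le_trans _ _ (Num.truncn (Lam / w))%:R).
      by rewrite ler_nat -ltnS.
    by rewrite truncn_le.
  split=> //; apply/andP; split; last exact: le_trans L1.
  by rewrite mulr_ge0 // ltW.
have acP i : (i < I)%N -> 0 <= acos (cc i) <= pi.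
  by move=> /ccP[/andP[h1 h2] _]; clear -h1 h2; rewrite acos_ge0 ?acos_lepi //; lra.
have kkP j : (j < J)%N -> l <= (kk j)%:R <= 3 * l.
  move=> jJ; rewrite /kk natrD natrM.
  have : (j%:R : R) <= l / (2 * D).
    apply: (@le_trans _ _ (Num.truncn (l / (2 * D)))%:R).
      by rewrite ler_nat -ltnS.
    by rewrite truncn_le.
  rewrite ler_pdivlMr ?mulr_gt0 // => jl.
  have j0 : 0 <= j%:R :> R by rewrite ler0n.
  by clear -jl j0 N1 N2 d1 d2 D0; apply/andP; split; nra.
have ttP j i : (j < J)%N -> (i < I)%N -> 4 * l <= tt j i <= 28 * l.
  move=> /kkP/andP[h1 h2] /acP/andP[h3 h4]; rewrite /tt.
  by clear -h1 h2 h3 h4 pi2 pi4 l1; apply/andP; split; nra.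
have csP j i : (i < I)%N -> cos (tt j i) = cc i /\ sin (tt j i) = sin (acos (cc i)).
  move=> /ccP[/andP[h1 h2] _]; rewrite /tt.
  have [-> ->] := cos_sin_natmul_2pi (kk j) (acos (cc i)); split=> //.
  by clear -h1 h2; rewrite acosK // in_itv /=; lra.
have z0E m : z m 0 0 = tt m.1 m.2 `^ (- p) * cc m.2.
  by rewrite /z spiral_point0 (csP _ _ (ltn_ord m.2)).1.
have z1E m : z m 0 1 = tt m.1 m.2 `^ (- q) * sin (acos (cc m.2)).
  by rewrite /z spiral_point1 (csP _ _ (ltn_ord m.2)).2.
have Fz m : (spiral p q) (z m).
  exists (tt m.1 m.2) => //=.
  have /andP[h _] := ttP _ _ (ltn_ord m.1) (ltn_ord m.2).
  by clear -h l1; lra.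
(* All points share a square of side rho/2, whose diagonal is at most rho, so any of them can be the
   centre of the ball. *)
have zbox m : 0 <= z m 0 0 <= rho / 2 /\ 0 <= z m 0 1 <= rho / 2.
  have /andP[h h'] := ttP _ _ (ltn_ord m.1) (ltn_ord m.2).
  have [/andP[c0 c1] cL] := ccP _ (ltn_ord m.2).
  have [s1 _] := half_le_sin_acos (ccP _ (ltn_ord m.2)).1.
  have sle : sin (acos (cc m.2)) <= 1 by exact: sin_le1.
  have s0 : 0 <= sin (acos (cc m.2)) by clear -s1; lra.
  have lt : l <= tt m.1 m.2 by clear -h l0; lra.
  rewrite z0E z1E (mulr_ge0 (powR_ge0 _ _) c0) (mulr_ge0 (powR_ge0 _ _) s0) /=; split.
    apply: le_trans Lp; rewrite mulrC ler_pM ?powR_ge0 //.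
    by apply: powRN_le_gt0 => //; exact: ltW.
  apply: le_trans lq; apply: (@le_trans _ _ (tt m.1 m.2 `^ (- q))).
    by rewrite ler_piMr ?powR_ge0.
  by apply: powRN_le_gt0 => //; exact: ltW.
have gap j j' i i' : (j < J)%N -> (j' < J)%N -> (i < I)%N -> (i' < I)%N -> (j < j')%N ->
    tt j i + 2 * D <= tt j' i'.
  move=> jJ j'J iI i'I jj'; rewrite /tt /kk !natrD !natrM.
  have /andP[h1 h2] := acP _ iI; have /andP[h3 h4] := acP _ i'I.
  by apply: angle_gap; rewrite // natr1 ler_nat.
have turns (m m' : 'I_J * 'I_I) : (m.1 < m'.1)%N ->
    ~ (forall j, `|z m 0 j - z m' 0 j| <= r).
  move=> mm' close.
  have g := gap _ _ _ _ (ltn_ord m.1) (ltn_ord m'.1) (ltn_ord m.2) (ltn_ord m'.2) mm'.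
  have /andP[h1 _] := ttP _ _ (ltn_ord m.1) (ltn_ord m.2).
  have /andP[_ h4] := ttP _ _ (ltn_ord m'.1) (ltn_ord m'.2).
  have [cP _] := ccP _ (ltn_ord m.2); have [cP' _] := ccP _ (ltn_ord m'.2).
  have [s1 ss] := half_le_sin_acos cP; have [s1' ss'] := half_le_sin_acos cP'.
  have close0 := le_trans (ler_norm _) (close 0).
  have close1 := le_trans (ler_norm _) (close 1).
  rewrite !z0E in close0; rewrite !z1E in close1.
  have p0q : 0 < p <= q by rewrite p0.
  have t1 : 1 <= tt m.1 m.2 by clear -h1 l1; lra.
  exact: (spiral_turns_separated p0q r0 l1 D1 DC t1 g h4 cP cP' s1 s1' ss ss'
    close0 close1).
have sameturn (m m' : 'I_J * 'I_I) : m.1 = m'.1 -> (m.2 < m'.2)%N ->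
    ~ (forall j, `|z m 0 j - z m' 0 j| <= r).
  move=> mm' lt2 /(_ 0); rewrite !z0E -mm'.
  have /andP[h3 h4] := ttP _ _ (ltn_ord m.1) (ltn_ord m'.2).
  have [/andP[c0 _] _] := ccP _ (ltn_ord m.2).
  have [/andP[_ c1'] _] := ccP _ (ltn_ord m'.2).
  have cw : cc m.2 + w <= cc m'.2.
    by rewrite /cc -[X in _ + X]mul1r -mulrDl natr1 ler_pM2r // ler_nat.
  have ttd : tt m.1 m'.2 <= tt m.1 m.2.
    rewrite /tt lerD2l; apply: acos_nincr.
    - by apply: le_trans c0; rewrite oppr_le0.
    - by apply: le_trans cw; rewrite lerDl ltW.
    - by apply: (le_trans c1'); rewrite ler_pdivrMr // mul1r ler1n.
  have t1 : 1 <= tt m.1 m'.2 by clear -h3 l1; lra.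
  by move=> h; apply: (spiral_arc_separated (ltW p0) r0 l0 t1 ttd h4 c0 cw h).
have sep (m m' : 'I_J * 'I_I) : (forall j, `|z m 0 j - z m' 0 j| <= r) -> m = m'.
  move=> close.
  have close' j : `|z m' 0 j - z m 0 j| <= r by rewrite distrC.
  have e1 : m.1 = m'.1.
    by apply: ord_ltn_total => h; [apply: turns h close|apply: turns h close'].
  have e2 : m.2 = m'.2.
    apply: ord_ltn_total => h; first exact: sameturn e1 h close.
    exact: sameturn (esym e1) h close'.
  by rewrite [m]surjective_pairing e1 e2 -surjective_pairing.
exists (z (ord0, ord0)); first exact: Fz.
move=> k /(separated_card_le (z := z)); rewrite card_prod !card_ord => /(_ _ sep) kJI.
apply: (@le_trans _ _ (J%:R * I%:R)); last first.
  rewrite -natrM ler_nat; apply: kJI => m; split=> //.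
  have [/andP[a1 a2] /andP[a3 a4]] := zbox m.
  have [/andP[b1 b2] /andP[b3 b4]] := zbox (ord0, ord0).
  have rho0 : 0 <= rho by clear -a1 a2; lra.
  rewrite /eucl_ball /= /eucl_dist !big_ord_recl big_ord0 addr0.
  rewrite -[leRHS](ger0_norm rho0) -sqrtr_sqr ler_wsqrtr //.
  have -> : lift ord0 ord0 = 1 :> 'I_2 by apply/val_inj.
  by clear -a1 a2 a3 a4 b1 b2 b3 b4 rho0; nra.
apply: (@le_trans _ _ (l / (2 * D) * (Lam / w))); last first.
  rewrite ler_pM // ltW //.
    by have /andP[_] := truncn_itv lD0.
  by have /andP[_] := truncn_itv Lw0.
rewrite le_eqVlt; apply/orP; left; apply/eqP.
rewrite /w powRN; field.
by rewrite !gt_eqF ?powR_gt0.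
Qed.

End LowerBound.

(** * Matching exponents *)

Section Exponents.
Context {R : realType}.
Implicit Types (p q theta s r u v a : R).

Lemma ler_powR_nincr r u v : 0 < r < 1 -> v <= u -> r `^ u <= r `^ v.
Proof. by move=> /andP[r0 r1] vu; apply: ger_powR; rewrite // r0 ltW. Qed.

(** A minimum is at most any weighted geometric mean; the weight 1/p is used when p >= 1. *)
Lemma min_le_powR u v a : 0 < u -> 0 < v -> 0 <= a <= 1 ->
  Num.min u v <= u `^ a * v `^ (1 - a).
Proof.
move=> u0 v0 /andP[a0 a1]; set m := Num.min u v.
have m0 : 0 < m by rewrite lt_min u0.
have -> : m = m `^ a * m `^ (1 - a).
  by rewrite -gt0_powRD // addrCA subrr addr0 powRr1 // ltW.
by rewrite ler_pM ?powR_ge0 //; apply: ge0_ler_powR;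
  rewrite ?nnegrE ?(ltW m0) ?(ltW u0) ?(ltW v0) ?subr_ge0 // /m ge_min lexx ?orbT.
Qed.

(** Gives the smallness conditions on [r] in the lower bounds a single form. *)
Lemma powR_small (K u : R) : 0 < u ->
  exists2 r0, 0 < r0 & forall r, 0 < r < r0 -> K * r `^ u <= 1.
Proof.
move=> u0; have K1 : 0 < `|K| + 1 by have := normr_ge0 K; lra.
exists ((`|K| + 1) `^ (- u^-1)); first by rewrite powR_gt0.
move=> r /andP[r0 rK].
have : r `^ u <= (`|K| + 1)^-1.
  rewrite -powR_inv1 ?(ltW K1) //.
  have -> : -1 = - u^-1 * u :> R by rewrite mulNr mulVf ?gt_eqF.
  rewrite powRrM; apply: ge0_ler_powR; rewrite ?nnegrE ?powR_ge0 ?(ltW u0) ?(ltW r0) //.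
  exact: ltW.
move=> h; apply: (@le_trans _ _ (`|K| * (`|K| + 1)^-1)).
  by apply: (le_trans (ler_wpM2r _ (ler_norm K))); rewrite ?powR_ge0 // ler_wpM2l.
by rewrite ler_pdivrMr // mul1r; lra.
Qed.

Lemma powRN_le1 (l e : R) : 0 < l -> 0 < e -> l `^ (- e) <= 1 -> 1 <= l.
Proof.
move=> l0 e0; rewrite powRN invf_le1 ?powR_gt0 // => h.
rewrite leNgt; apply/negP => l1.
have := @gt0_ltr_powR R e e0 l 1; rewrite !nnegrE ler01 (ltW l0) l1 powR1.
by move=> /(_ isT isT isT); rewrite ltNge h.
Qed.

Lemma ratio_powR r theta s : 0 < r ->
  (r `^ theta / r) `^ s = r `^ (- (1 - theta) * s).
Proof. by move=> r0; rewrite powRB_id // powRrM. Qed.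

(** With H = h r^eta the covering bound is a constant times r^-(1 + (1 - a)/(1 + q) - eta), so only
    exponents of [r] remain to be compared. *)
Lemma spiral_spectrum_upper p q theta s a eta h :
  0 < p <= q -> 0 <= theta < 1 -> 0 <= a < 1 -> 0 < h ->
  (forall r t, 0 < r < 1 -> 1 <= t ->
     Num.min (t `^ (- p)) (r `^ theta) <= h * r `^ eta * t `^ (- a)) ->
  1 + (1 - a) / (1 + q) - eta <= (1 - theta) * s ->
  exists2 C, 0 < C & forall r x, 0 < r < 1 ->
    (spiral p q) x ->
    cubes_suffice r (eucl_ball x (r `^ theta) `&`
      spiral p q) (C * (r `^ theta / r) `^ s).
Proof.
move=> pq /andP[th0 th1] a01 h0 minh es; case/andP: (a01) => a0 a1.
have c0 : 0 < 64 * 2 `^ p / (1 - a) + 13 :> R.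
  by rewrite addr_gt0 // divr_gt0 ?mulr_gt0 ?powR_gt0 //; lra.
exists ((64 * 2 `^ p / (1 - a) + 13) * h); first by rewrite mulr_gt0.
move=> r x r01 Fx; have /andP[r0 r1] := r01.
have rr : r <= r `^ theta.
  by rewrite -[leLHS](powRr1 (ltW r0)); apply: ler_powR_nincr => //; exact: ltW.
apply: cubes_suffice_le (cubes_suffice_spiral x pq a01 r01 rr (fun t => minh r t r01)) => //.
rewrite -[leRHS]mulrA ler_pM2l // ratio_powR // -!mulrA ler_pM2l //.
rewrite -powRrM -(powR_inv1 (ltW r0)) -!gt0_powRD //.
apply: ler_powR_nincr => //; move: es; rewrite !mulNr [(1 + q)^-1 * _]mulrC; lra.
Qed.

(** Takes rho = r^theta in [spiral_many_separated], with parameters depending on [r]. *)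
Lemma spiral_spectrum_ge p q theta s (c K u : R) (l D Lam : R -> R) :
  0 < p <= q -> 0 <= theta < 1 -> 0 < c -> 0 < u ->
  (forall r, 0 < r < 1 -> K * r `^ u <= 1 ->
     [/\ 1 <= l r, 1 <= D r,
         4 * 28 `^ (q + 1) / q * (r * l r `^ (q + 1)) <= D r,
         l r `^ (- q) <= r `^ theta / 2 &
         [/\ 0 <= Lam r <= 1 / 2, Lam r * l r `^ (- p) <= r `^ theta / 2 &
         c * r `^ (- (1 - theta) * s) <= l r / D r * (Lam r * l r `^ (- p) / r)]]) ->
  (s%:E <= assouad_spectrum theta (spiral p q))%E.
Proof.
move=> pq th c0 u0 H; have [r0 r00 r0P] := powR_small K u0.
have d0 : 0 < (4 * 28 `^ p)^-1 :> R by rewrite invr_gt0 mulr_gt0 // powR_gt0.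
apply: (@assouad_spectrum_ge _ _ theta s ((4 * 28 `^ p)^-1 * c)) => //.
  exact: mulr_gt0.
exists (Num.min r0 1); first by rewrite lt_min r00 /=.
move=> r; rewrite lt_min => /and3P[rgt0 rr0 r1].
have [||l1 D1 DC lq [Lam01 Lp cl]] := H r; [by rewrite rgt0|by apply: r0P; rewrite rgt0|].
have [x Fx xP] := spiral_many_separated pq rgt0 l1 D1 DC lq Lam01 Lp.
exists x => // k /xP; apply: le_trans.
by rewrite ratio_powR // -[leLHS]mulrA ler_pM2l.
Qed.

End Exponents.

(** * Upper and lower bounds in each range of theta *)

Section Spectrum.
Context {R : realType}.
Implicit Types (p q theta s r : R).
Lemma gap_constant_gt0 q : 0 < q -> 0 < 4 * 28 `^ (q + 1) / q.
Proof. by move=> q0; rewrite divr_gt0 // mulr_gt0 // powR_gt0. Qed.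

Lemma powR_scaled (lam x y r : R) : 0 < lam -> 0 < r ->
  (lam * r `^ x) `^ y = lam `^ y * r `^ (x * y).
Proof. by move=> l0 r0; rewrite powRM ?powR_ge0 ?(ltW l0) // powRrM. Qed.

(* Chosen so that consecutive turns of index about [scale q * r^(-1/(1+q))] are
   vertically separated at scale r. *)
Definition scale q : R := Num.min 1 ((4 * 28 `^ (q + 1) / q) `^ (- (q + 1)^-1)).

Lemma scale_gt0 q : 0 < q -> 0 < scale q.
Proof. by move=> q0; rewrite lt_min ltr01 powR_gt0 // gap_constant_gt0. Qed.

Lemma scale_le1 q : scale q <= 1.
Proof. by rewrite ge_min lexx. Qed.

(** The powers of [r] cancel; this is the separation condition with D = 1, so every turn may be
    used. *)
Lemma scale_gap q r : 0 < q -> 0 < r ->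
  4 * 28 `^ (q + 1) / q * (r * (scale q * r `^ (- (1 + q)^-1)) `^ (q + 1)) <= 1.
Proof.
move=> q0 r0; have C1_gt0 := gap_constant_gt0 q0; have s0 := scale_gt0 q0.
rewrite powR_scaled //.
have -> : - (1 + q)^-1 * (q + 1) = -1 by field; lra.
rewrite powR_inv1 ?(ltW r0) // [r * _]mulrCA divff ?gt_eqF // mulr1.
have : scale q `^ (q + 1) <= (4 * 28 `^ (q + 1) / q)^-1.
  rewrite -[leRHS]powR_inv1 ?(ltW C1_gt0) //.
  have -> : -1 = - (q + 1)^-1 * (q + 1) :> R by field; lra.
  rewrite powRrM; apply: ge0_ler_powR; rewrite ?nnegrE ?powR_ge0 ?(ltW s0) //; first lra.
  by rewrite ge_min lexx orbT.
by move=> h; rewrite -[leRHS](mulfV (lt0r_neq0 C1_gt0)) ler_pM2l.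
Qed.

Lemma half_powR_le1 theta r : 0 <= theta -> 0 < r < 1 -> r `^ theta / 2 <= 1.
Proof.
move=> th0 r01; have : r `^ theta <= r `^ 0 by apply: ler_powR_nincr.
by rewrite powRr0; lra.
Qed.

Lemma spiral_spectrum_le_steep p q theta s :
  0 < p -> p <= q -> 0 <= theta -> theta < 1 -> p < 1 ->
  (2 + q - p) / (1 + q) <= (1 - theta) * s -> 0 <= s ->
  (assouad_spectrum theta (spiral p q) <= s%:E)%E.
Proof.
move=> p0 pq th0 th1; have p0q : 0 < p <= q by rewrite p0.
have q0 : 0 < q by exact: lt_le_trans pq.
have th01 : 0 <= theta < 1 by rewrite th0.
move=> p1 es s0; apply: assouad_spectrum_le => // e e0.
apply: (@spiral_spectrum_upper _ p q theta _ p 0 1) => //; first by rewrite ltW.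
  by move=> r t r01 t1; rewrite powRr0 !mul1r ge_min lexx.
have -> : 1 + (1 - p) / (1 + q) - 0 = (2 + q - p) / (1 + q) by field; lra.
by apply: (le_trans es); rewrite ler_wpM2l //; lra.
Qed.

Lemma spiral_spectrum_le_flat p q theta s :
  0 < p -> p <= q -> 0 <= theta -> theta < 1 -> 1 <= p ->
  1 - theta + theta / p <= (1 - theta) * s -> 0 <= s ->
  (assouad_spectrum theta (spiral p q) <= s%:E)%E.
Proof.
move=> p0 pq th0 th1; have p0q : 0 < p <= q by rewrite p0.
have q0 : 0 < q by exact: lt_le_trans pq.
have th01 : 0 <= theta < 1 by rewrite th0.
move=> p1 es s0; apply: assouad_spectrum_le => // e e0.
(* The weight a = 1 would give a divergent sum; a = 1 - e' raises the exponent of 1/r by e'/(1 + q),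
   which fits into the slack e (1 - theta), and e' <= 1/2 keeps a nonnegative. *)
set e' := Num.min (1 / 2) (e * (1 - theta) * (1 + q)).
have e'0 : 0 < e' by rewrite lt_min !mulr_gt0 //; lra.
have e'1 : e' <= 1 / 2 by rewrite /e' ge_min lexx.
have e'2 : e' / (1 + q) <= e * (1 - theta).
  by rewrite ler_pdivrMr ?ge_min ?lexx ?orbT //; lra.
have ip : 0 <= p^-1 <= 1 by rewrite invr_ge0 ltW //= invf_le1.
apply: (@spiral_spectrum_upper _ p q theta _ (1 - e') (theta * (1 - p^-1)) 1) => //.
- lra.
- move=> r t /andP[r0 r1] t1; have t0 : 0 < t by lra.
  have tp0 : 0 < t `^ (- p) by rewrite powR_gt0.
  have rt0 : 0 < r `^ theta by rewrite powR_gt0.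
  apply: le_trans (min_le_powR tp0 rt0 ip) _.
  rewrite -!powRrM mul1r mulrC ler_wpM2l ?powR_ge0 //.
  by apply: ler_powR => //; rewrite mulNr mulfV ?gt_eqF //; lra.
- have -> : 1 - (1 - e') = e' by ring.
  have -> : theta * (1 - p^-1) = theta - theta / p by ring.
  rewrite [leRHS]mulrDr [_ * e]mulrC; lra.
Qed.

Lemma spiral_spectrum_le_mid p q theta s :
  0 < p -> p <= q -> 0 <= theta -> theta < 1 ->
  1 - theta + (1 + q)^-1 <= (1 - theta) * s -> 0 <= s ->
  (assouad_spectrum theta (spiral p q) <= s%:E)%E.
Proof.
move=> p0 pq th0 th1; have p0q : 0 < p <= q by rewrite p0.
have q0 : 0 < q by exact: lt_le_trans pq.
have th01 : 0 <= theta < 1 by rewrite th0.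
move=> es s0; apply: assouad_spectrum_le => // e e0.
apply: (@spiral_spectrum_upper _ p q theta _ 0 theta 1) => //; first by rewrite lexx ltr01.
  by move=> r t r01 t1; rewrite oppr0 powRr0 mulr1 mul1r ge_min lexx orbT.
have : (1 - theta) * s <= (1 - theta) * (s + e) by rewrite ler_wpM2l //; lra.
by rewrite subr0 mul1r; lra.
Qed.

Lemma assouad_spectrum_le2 theta (E : set 'rV[R]_2) :
  0 <= theta -> theta < 1 -> (assouad_spectrum theta E <= 2%:E)%E.
Proof.
move=> th0 th1; apply: assouad_spectrum_le => // e e0; exists 9 => // r x r01 _.
have /andP[r0 r1] := r01.
have rr : r <= r `^ theta.
  by rewrite -[leLHS](powRr1 (ltW r0)); apply: ler_powR_nincr => //; exact: ltW.
apply: cubes_suffice_le (cubes_suffice_ball E x r0 rr) => //.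
have h : 1 <= r `^ theta / r by rewrite ler_pdivlMr // mul1r.
rewrite ler_pM2l // -powR_mulrn; last by lra.
by apply: ler_powR => //; lra.
Qed.

(** For theta < p/(1 + q) the turns near [kappa] are narrower than the ball, so a fixed fraction of
    their width is used. *)
Lemma spiral_spectrum_ge_steep p q theta s :
  0 < p -> p <= q -> 0 <= theta -> theta < 1 -> theta < p / (1 + q) ->
  (1 - theta) * s = (2 + q - p) / (1 + q) ->
  (s%:E <= assouad_spectrum theta (spiral p q))%E.
Proof.
move=> p0 pq th0 th1; have p0q : 0 < p <= q by rewrite p0.
have q0 : 0 < q by exact: lt_le_trans pq.
have th01 : 0 <= theta < 1 by rewrite th0.
have sc0 := scale_gt0 q0.
move=> thp es; pose l r := scale q * r `^ (- (1 + q)^-1) : R.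
apply: (@spiral_spectrum_ge _ p q theta s (scale q * (1 / 2 * scale q `^ (- p)))
  (2 * scale q `^ (- p)) (p / (1 + q) - theta) l (fun=> 1) (fun=> 1 / 2)) => //.
- by rewrite !mulr_gt0 ?powR_gt0 ?gap_constant_gt0.
- by rewrite subr_gt0.
move=> r r01 small; have /andP[r0 r1] := r01.
have lp : l r `^ (- p) = scale q `^ (- p) * r `^ (p / (1 + q)).
  by rewrite /l powR_scaled //; congr (_ * _ `^ _); rewrite mulrNN mulrC.
have lple : l r `^ (- p) <= r `^ theta / 2.
  rewrite lp (_ : p / (1 + q) = (p / (1 + q) - theta) + theta); last by ring.
  rewrite gt0_powRD //; have : 0 <= r `^ theta by rewrite powR_ge0.
  by move: small; set A := scale q `^ _; set B := r `^ _; nra.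
have l0 : 0 < l r by rewrite mulr_gt0 // powR_gt0.
have l1 : 1 <= l r.
  by apply: (@powRN_le1 _ _ p) => //; apply: (le_trans lple); exact: half_powR_le1.
split=> //.
- exact: scale_gap.
- by apply: le_trans lple; apply: ler_powR => //; rewrite lerN2.
split=> //; first by lra.
- by apply: le_trans lple; rewrite ler_piMl ?powR_ge0 //; lra.
rewrite mulNr es lp divr1 /l le_eqVlt; apply/orP; left; apply/eqP.
have -> : - ((2 + q - p) / (1 + q)) = - (1 + q)^-1 + p / (1 + q) + -1 by field; lra.
rewrite !gt0_powRD // (powR_inv1 (ltW r0)).
by ring.
Qed.

(** [Lam] cuts the arcs to width r^theta / 2. The bound p/(1 + q) <= theta keeps Lam <= 1/2, and
    theta < q/(1 + q) makes the height of the turns fit in the ball. *)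
Lemma spiral_spectrum_ge_mid p q theta s :
  0 < p -> p <= q -> 0 <= theta -> theta < 1 -> p / (1 + q) <= theta < q / (1 + q) ->
  (1 - theta) * s = 1 - theta + (1 + q)^-1 ->
  (s%:E <= assouad_spectrum theta (spiral p q))%E.
Proof.
move=> p0 pq th0 th1; have p0q : 0 < p <= q by rewrite p0.
have q0 : 0 < q by exact: lt_le_trans pq.
have th01 : 0 <= theta < 1 by rewrite th0.
have sc0 := scale_gt0 q0.
move=> /andP[thp thq] es; pose l r := scale q * r `^ (- (1 + q)^-1) : R.
apply: (@spiral_spectrum_ge _ p q theta s (scale q * (1 / 2))
  (2 * scale q `^ (- q)) (q / (1 + q) - theta) l (fun=> 1)
  (fun r => 1 / 2 * (l r `^ p * r `^ theta))) => //.
- by rewrite !mulr_gt0 ?powR_gt0 ?gap_constant_gt0.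
- by rewrite subr_gt0.
move=> r r01 small; have /andP[r0 r1] := r01.
have lq : l r `^ (- q) = scale q `^ (- q) * r `^ (q / (1 + q)).
  by rewrite /l powR_scaled //; congr (_ * _ `^ _); rewrite mulrNN mulrC.
have lqle : l r `^ (- q) <= r `^ theta / 2.
  rewrite lq (_ : q / (1 + q) = (q / (1 + q) - theta) + theta); last by ring.
  rewrite gt0_powRD //; have : 0 <= r `^ theta by rewrite powR_ge0.
  by move: small; set A := scale q `^ _; set B := r `^ _; nra.
have l0 : 0 < l r by rewrite mulr_gt0 // powR_gt0.
have l1 : 1 <= l r.
  by apply: (@powRN_le1 _ _ q) => //; apply: (le_trans lqle); exact: half_powR_le1.
have lp1 : l r `^ p * r `^ theta <= 1.
  rewrite /l powR_scaled // -mulrA -gt0_powRD //.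
  apply: mulr_ile1; rewrite ?powR_ge0 //.
    apply: (@le_trans _ _ (1 `^ p)); last by rewrite powR1.
    by apply: ge0_ler_powR; rewrite ?nnegrE ?(ltW p0) ?(ltW sc0) ?scale_le1.
  rewrite -[leRHS](powRr0 r); apply: ler_powR_nincr => //.
  by move: thp; rewrite mulNr [_^-1 * _]mulrC; lra.
have lp0 : 0 <= l r `^ p * r `^ theta by rewrite mulr_ge0 ?powR_ge0.
have lpE : 1 / 2 * (l r `^ p * r `^ theta) * l r `^ (- p) = 1 / 2 * r `^ theta.
  rewrite powRN; field; by rewrite gt_eqF ?powR_gt0.
split=> //; first exact: scale_gap.
rewrite lpE; split; [lra|lra|].
rewrite mulNr es divr1 /l le_eqVlt; apply/orP; left; apply/eqP.
have -> : - (1 - theta + (1 + q)^-1) = - (1 + q)^-1 + theta + -1 by ring.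
rewrite !gt0_powRD // (powR_inv1 (ltW r0)).
by ring.
Qed.

(** The turns used have width comparable to r^theta; the factor 2 in [l] gives l^-p <= r^theta / 2
    because p >= 1. As theta < p/(1 + q), r l^(q+1) tends to 0 and D = 1 is allowed. *)
Lemma spiral_spectrum_ge_flat p q theta s :
  0 < p -> p <= q -> 0 <= theta -> theta < 1 -> 1 <= p -> theta < p / (1 + q) ->
  (1 - theta) * s = 1 - theta + theta / p ->
  (s%:E <= assouad_spectrum theta (spiral p q))%E.
Proof.
move=> p0 pq th0 th1; have p0q : 0 < p <= q by rewrite p0.
have q0 : 0 < q by exact: lt_le_trans pq.
have th01 : 0 <= theta < 1 by rewrite th0.
move=> p1 thp es; pose l r := 2 * r `^ (- (theta / p)) : R.
apply: (@spiral_spectrum_ge _ p q theta s (2 * (1 / 2 * 2 `^ (- p)))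
  (4 * 28 `^ (q + 1) / q * 2 `^ (q + 1)) (1 - theta * (1 + q) / p) l (fun=> 1)
  (fun=> 1 / 2)) => //.
- by rewrite subr_gt0 ltr_pdivrMr // mul1r -ltr_pdivlMr //; lra.
move=> r r01 small; have /andP[r0 r1] := r01.
have lp : l r `^ (- p) = 2 `^ (- p) * r `^ theta.
  by rewrite /l powR_scaled //; congr (_ * _ `^ _); field; rewrite gt_eqF.
have rt0 : 0 <= r `^ theta by rewrite powR_ge0.
have lple : l r `^ (- p) <= r `^ theta / 2.
  rewrite lp mulrC ler_wpM2l // -[leRHS]powR_inv1 //.
  by apply: ler_powR; rewrite ?ler1n // lerN2.
have l1 : 1 <= l r.
  have : r `^ 0 <= r `^ (- (theta / p)).
    by apply: ler_powR_nincr => //; rewrite oppr_le0 divr_ge0 // ltW.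
  by rewrite powRr0 /l; lra.
split=> //.
- apply: le_trans small; rewrite /l powR_scaled // le_eqVlt; apply/orP; left; apply/eqP.
  have -> : 1 - theta * (1 + q) / p = 1 + - (theta / p) * (q + 1) by field; rewrite gt_eqF.
  by rewrite (gt0_powRD 1 _ r0) (powRr1 (ltW r0)); ring.
- by apply: le_trans lple; apply: ler_powR => //; rewrite lerN2.
split=> //; first by lra.
- by apply: le_trans lple; rewrite ler_piMl ?powR_ge0 //; lra.
rewrite mulNr es lp divr1 /l le_eqVlt; apply/orP; left; apply/eqP.
have -> : - (1 - theta + theta / p) = - (theta / p) + theta + -1 by ring.
rewrite !gt0_powRD // (powR_inv1 (ltW r0)).
by ring.
Qed.

(** Here l^-q = r^theta / 2 exactly. Turns of this index may be closer than r, so [D] skips some of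
    them, and [Lam] cuts the arcs to width r^theta / 4; the count is (r^theta / r)^2 / (8C). *)
Lemma spiral_spectrum_ge_full p q theta :
  0 < p -> p <= q -> 0 <= theta -> theta < 1 ->
  q / (1 + q) <= theta ->
  (2%:E <= assouad_spectrum theta (spiral p q))%E.
Proof.
move=> p0 pq th0 th1; have p0q : 0 < p <= q by rewrite p0.
have q0 : 0 < q by exact: lt_le_trans pq.
have th01 : 0 <= theta < 1 by rewrite th0.
move=> thq; pose l r := 2 `^ (q^-1) * r `^ (- (theta / q)) : R.
(* The added 1 ensures D >= 1, since r l^(q+1) >= 1 when theta >= q/(1 + q). *)
pose C := 4 * 28 `^ (q + 1) / q + 1.
have C0 : 0 < C by rewrite addr_gt0 // gap_constant_gt0.
apply: (@spiral_spectrum_ge _ p q theta 2 ((8 * C)^-1) 0 1 l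
  (fun r => C * (r * l r `^ (q + 1))) (fun r => 1 / 2 * l r `^ (p - q))) => //.
- by rewrite invr_gt0 mulr_gt0.
move=> r r01 _; have /andP[r0 r1] := r01.
have two0 : 0 < 2 `^ q^-1 :> R by rewrite powR_gt0.
have rt0 : 0 < r `^ theta by rewrite powR_gt0.
have lq : l r `^ (- q) = r `^ theta / 2.
  rewrite /l powR_scaled // -powRrM mulrN mulVf ?gt_eqF // powR_inv1 // mulrC.
  by congr (_ `^ _ / 2); field; rewrite gt_eqF.
have l0 : 0 < l r by rewrite mulr_gt0 // powR_gt0.
have l1 : 1 <= l r.
  by apply: (@powRN_le1 _ _ q) => //; rewrite lq; exact: half_powR_le1.
have rl1 : 1 <= r * l r `^ (q + 1).
  have -> : r * l r `^ (q + 1) = 2 `^ (q^-1 * (q + 1)) * r `^ (1 - theta * (1 + q) / q).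
    rewrite /l powR_scaled // -powRrM mulrCA -[X in _ * (X * _)](powRr1 (ltW r0)) -gt0_powRD //.
    by congr (_ * _ `^ _); field; rewrite gt_eqF.
  rewrite -[leLHS]mulr1 ler_pM //.
    rewrite -[leLHS](powRr0 2); apply: ler_powR; rewrite ?ler1n //.
    by rewrite mulr_ge0 ?invr_ge0 //; lra.
  rewrite -[leLHS](powRr0 r); apply: ler_powR_nincr => //.
  by rewrite subr_le0 ler_pdivlMr // mul1r -ler_pdivrMr //; lra.
have LE : 1 / 2 * l r `^ (p - q) * l r `^ (- p) = 1 / 4 * r `^ theta.
  rewrite -mulrA -gt0_powRD //.
  have -> : p - q - p = - q by ring.
  by rewrite lq; field.
have rl0 : 0 <= r * l r `^ (q + 1) by lra.
split=> //.
- have : 0 <= (C - 1) * (r * l r `^ (q + 1)).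
    by apply: mulr_ge0 => //; rewrite /C addrK ltW // gap_constant_gt0.
  by rewrite mulrBl mul1r; lra.
- by rewrite ler_wpM2r // /C lerDl.
- by rewrite lq.
split.
- have : l r `^ (p - q) <= l r `^ 0 by apply: ler_powR => //; lra.
  have : 0 <= l r `^ (p - q) by rewrite powR_ge0.
  by rewrite powRr0; lra.
- by rewrite LE; lra.
rewrite LE -ratio_powR // powR_mulrn; last by rewrite divr_ge0 // ltW.
have -> : l r `^ (q + 1) = l r * (2 / r `^ theta).
  rewrite gt0_powRD // (powRr1 (ltW l0)) mulrC; congr (_ * _).
  by rewrite -[LHS]invrK -powRN lq invf_div.
rewrite le_eqVlt; apply/orP; left; apply/eqP.
by field; rewrite !gt_eqF.
Qed.

End Spectrum.

Theorem theorem2p6 (R : realType) (p q theta : R) (hp : 0 < p) (hpq : p <= q)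
  (htheta : 0 <= theta < 1) :
  (p < 1 ->
     assouad_spectrum theta (@plane_of_complex R @` elliptical_spiral p q) =
     (if theta < p / (1 + q) then
        (2 + q - p) / ((1 + q) * (1 - theta))
      else if theta < q / (1 + q) then
        (2 + q - theta * (1 + q)) / ((1 + q) * (1 - theta))
      else 2)%:E) /\
  (1 <= p ->
     assouad_spectrum theta (@plane_of_complex R @` elliptical_spiral p q) =
     (if theta < p / (1 + q) then
        (p - theta * (p - 1)) / (p * (1 - theta))
      else if theta < q / (1 + q) then
        (2 + q - theta * (1 + q)) / ((1 + q) * (1 - theta))
      else 2)%:E).
Proof.
rewrite elliptical_spiralE; have /andP[th0 th1] := htheta.
(* The ranges from p/(1 + q) on have the same formula for p < 1 and p >= 1, so they are settled
   once. *)
have mid : p / (1 + q) <= theta ->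
    assouad_spectrum theta (spiral p q) =
    (if theta < q / (1 + q) then
       (2 + q - theta * (1 + q)) / ((1 + q) * (1 - theta)) else 2)%:E.
  move=> pth; case: ltP => qth; apply/eqP; rewrite eq_le; apply/andP; split.
  - apply: spiral_spectrum_le_mid => //.
      by rewrite le_eqVlt; apply/orP; left; apply/eqP; field; lra.
    by apply: divr_ge0; [nra|apply: mulr_ge0; lra].
  - apply: spiral_spectrum_ge_mid => //; first by rewrite pth.
    by field; lra.
  - exact: assouad_spectrum_le2.
  - exact: spiral_spectrum_ge_full.
split=> p1; case: (ltP theta (p / (1 + q))) => pth; try exact: mid.
  apply/eqP; rewrite eq_le; apply/andP; split.
  - apply: spiral_spectrum_le_steep => //.
      by rewrite le_eqVlt; apply/orP; left; apply/eqP; field; lra.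
    by apply: divr_ge0; [lra|apply: mulr_ge0; lra].
  - apply: spiral_spectrum_ge_steep => //.
    by field; lra.
apply/eqP; rewrite eq_le; apply/andP; split.
- apply: spiral_spectrum_le_flat => //.
    by rewrite le_eqVlt; apply/orP; left; apply/eqP; field; lra.
  by apply: divr_ge0; [nra|apply: mulr_ge0; lra].
- apply: spiral_spectrum_ge_flat => //.
  by field; lra.
Qed.
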